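(* Let $\mathcal{M}$ and $\mathcal{N}$ be $C^1$-manifolds. Every locally Lipschitz function $f:\mathcal{M}\to\mathcal{N}$ is differentiable almost everywhere on $\mathcal{M}$.
   Context: Manifolds are finite-dimensional, Hausdorff and second countable. A function $f:\mathcal{M}\to\mathcal{N}$ between $C^1$-manifolds is locally Lipschitz if, for each $x\in\mathcal{M}$, there exist a coordinate chart $(U,\varphi)$ on $\mathcal{M}$ at $x$ and a coordinate chart $(W,\psi)$ on $\mathcal{N}$ at $f(x)$ such that the function $\psi\circ f\circ\varphi^{-1}:\varphi(U\cap f^{-1}(W))\to\psi(W)$ is locally Lipschitz as a function between Euclidean spaces, where $f^{-1}(W)=\{x\in\mathcal{M}: f(x)\in W\}$. ''Differentiable at $x$'' means that $\psi\circ f\circ\varphi^{-1}$ is differentiable at $\varphi(x)$ for some charts $(U,\varphi)$ of $\mathcal{M}$ at $x$ and $(W,\psi)$ of $\mathcal{N}$ at $f(x)$. ''Almost everywhere'' means outside a subset of $\mathcal{M}$ of Lebesgue measure zero, i.e., one whose image under every coordinate chart has Lebesgue measure zero. *)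

(* Defs.v *)
From HB Require Import structures.
From mathcomp Require Import all_boot all_order all_algebra.
From mathcomp Require Import all_classical all_reals all_analysis.

Set Implicit Arguments.
Unset Strict Implicit.
Unset Printing Implicit Defensive.

Import Order.TTheory GRing.Theory Num.Theory.
Import numFieldNormedType.Exports.

Local Open Scope classical_set_scope.
Local Open Scope ring_scope.

(** R^n is ['rV[R]_n] with its library topology and norm.  That norm is the sup
    norm; it is equivalent to the Euclidean one, so the notions below that
    mention it (Lipschitz, differentiable) do not depend on this choice. *)

(** ** Lebesgue null sets of R^n *)

Definition box (R : realType) (n : nat) (a b : 'rV[R]_n) : set 'rV[R]_n :=
  [set x | forall i, a 0 i <= x 0 i <= b 0 i].

Definition box_volume (R : realType) (n : nat) (a b : 'rV[R]_n) : R :=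
  \prod_(i < n) (b 0 i - a 0 i).

(** Lebesgue outer measure zero.  The boxes are indexed by a subset [I] of [nat]
    so that finite and empty covers are allowed: R^0 has no box of volume less
    than 1, and there only the empty set is null. *)
Definition lebesgue_null (R : realType) (n : nat) (A : set 'rV[R]_n) : Prop :=
  forall eps : R, 0 < eps ->
  exists (I : set nat) (a b : nat -> 'rV[R]_n),
    [/\ forall k i, a k 0 i <= b k 0 i,
        A `<=` \bigcup_(k in I) box (a k) (b k)
      & (\esum_(k in I) (box_volume (a k) (b k))%:E <= eps%:E)%E].

(** ** Calculus on subsets of R^n *)

Definition C1_on (R : realType) (m n : nat) (D : set 'rV[R]_m)
    (F : 'rV[R]_m -> 'rV[R]_n) : Prop :=
  forall x, D x -> differentiable F x /\ {for x, continuous (jacobian F)}.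

Definition locally_lipschitz_on (R : realType) (m n : nat) (D : set 'rV[R]_m)
    (F : 'rV[R]_m -> 'rV[R]_n) : Prop :=
  forall x, D x -> exists2 V, nbhs x V & [lipschitz F y | y in D `&` V].

(** Differentiability at [x] of a function with domain [D]: the first-order
    expansion holds as y tends to x within [D].  For [D] a neighbourhood of [x]
    this is [differentiable F x]; see [differentiable_on_nbhs]. *)
Definition differentiable_on (R : realType) (m n : nat) (D : set 'rV[R]_m)
    (F : 'rV[R]_m -> 'rV[R]_n) (x : 'rV[R]_m) : Prop :=
  differentiable F (within D (nbhs x)).

(** ** C^1-manifolds *)

(** An n-dimensional chart of a topological space: a homeomorphism from an open
    set onto an open subset of R^n.  Both it and its inverse are given by total
    functions, whose values outside [chart_dom] and its image are irrelevant. *)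
Record chart (R : realType) (M : topologicalType) (n : nat) : Type := Chart {
  chart_dom : set M;
  chart_map :> M -> 'rV[R]_n;
  chart_inv : 'rV[R]_n -> M;
  chart_dom_open : open chart_dom;
  chart_img_open : open (chart_map @` chart_dom);
  chart_mapK : forall x, chart_dom x -> chart_inv (chart_map x) = x;
  chart_map_continuous : {within chart_dom, continuous chart_map};
  chart_inv_continuous :
    {within chart_map @` chart_dom, continuous chart_inv} }.

Definition C1_transition (R : realType) (M : topologicalType) (n : nat)
    (c d : chart R M n) : Prop :=
  C1_on (c @` (chart_dom c `&` chart_dom d)) (d \o chart_inv c).

Definition C1_compatible (R : realType) (M : topologicalType) (n : nat)
    (c d : chart R M n) : Prop :=
  C1_transition c d /\ C1_transition d c.

(** [coordinate_chart] is the maximal C^1-atlas. *)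
Record C1manifold (R : realType) : Type := C1Manifold {
  carrier :> topologicalType;
  dim : nat;
  coordinate_chart : set (chart R carrier dim);
  manifold_hausdorff : hausdorff_space carrier;
  manifold_second_countable : @second_countable carrier;
  charts_cover : forall x : carrier,
    exists2 c, coordinate_chart c & chart_dom c x;
  charts_compatible : forall c d,
    coordinate_chart c -> coordinate_chart d -> C1_compatible c d;
  charts_maximal : forall c,
    (forall d, coordinate_chart d -> C1_compatible c d) -> coordinate_chart c }.

Definition chart_at (R : realType) (M : C1manifold R) (x : M)
    (c : chart R M (dim M)) : Prop :=
  coordinate_chart c /\ chart_dom c x.

(** ** Functions between C^1-manifolds *)

(** psi o f o phi^-1 and its domain phi (U `&` f^-1 W), for charts (U, phi) = c
    and (W, psi) = d. *)
Definition local_rep (R : realType) (M N : C1manifold R) (f : M -> N)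
    (c : chart R M (dim M)) (d : chart R N (dim N)) :
    'rV[R]_(dim M) -> 'rV[R]_(dim N) :=
  d \o f \o chart_inv c.

Definition local_rep_dom (R : realType) (M N : C1manifold R) (f : M -> N)
    (c : chart R M (dim M)) (d : chart R N (dim N)) : set 'rV[R]_(dim M) :=
  c @` (chart_dom c `&` f @^-1` chart_dom d).

Definition locally_lipschitz (R : realType) (M N : C1manifold R)
    (f : M -> N) : Prop :=
  forall x, exists c d, [/\ chart_at x c, chart_at (f x) d
    & locally_lipschitz_on (local_rep_dom f c d) (local_rep f c d)].

(** The definition of [locally_lipschitz] does not force [local_rep_dom] to be
    open (the indicator function of the rationals satisfies it, taking a small
    chart at its value), whence the use of [differentiable_on].  When [f] is
    continuous the domain is open and this is ordinary differentiability of the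
    local representative; see [differentiable_atP]. *)
Definition differentiable_at (R : realType) (M N : C1manifold R)
    (f : M -> N) (x : M) : Prop :=
  exists c d, [/\ chart_at x c, chart_at (f x) d
    & differentiable_on (local_rep_dom f c d) (local_rep f c d) (c x)].

Definition measure_zero (R : realType) (M : C1manifold R) (Z : set M) : Prop :=
  forall c : chart R M (dim M), coordinate_chart c ->
    lebesgue_null (c @` (Z `&` chart_dom c)).

Definition almost_everywhere_on (R : realType) (M : C1manifold R)
    (P : M -> Prop) : Prop :=
  exists2 Z, measure_zero Z & forall x, ~ Z x -> P x.

(** ** Agreement with ordinary differentiability *)

Lemma differentiable_filterP (R : realType) (m n : nat)
    (F : 'rV[R]_m -> 'rV[R]_n) (G : filter_on 'rV[R]_m) (x : 'rV[R]_m) :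
  lim G = x ->
  differentiable F G <->
  exists2 L : {linear 'rV[R]_m -> 'rV[R]_n}, continuous L &
    forall eps : R, 0 < eps ->
      \forall y \near G, `|F y - (F x + L (y - x))| <= eps * `|y - x|.
Proof.
move=> Gx; split.
  move=> /diffP; rewrite Gx => -[Lc FE]; exists ('d F G) => // e e0.
  have /eqaddoP/(_ e e0) := funext FE.
  by apply: filterS => y /=.
move=> [L Lc FL]; apply/diffP.
rewrite /diff; set P := (X in get X).
suff PL : P L by exact: (getPex (ex_intro _ L PL)).
rewrite /P Gx; split=> // y.
have /(congr1 (@^~ y)) := iffRL (eqaddoP G F (fun z => F x + L (z - x)) (center x))
  (fun e e0 => FL e e0).
by [].
Qed.

Lemma differentiable_onP (R : realType) (m n : nat) (D : set 'rV[R]_m)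
    (F : 'rV[R]_m -> 'rV[R]_n) (x : 'rV[R]_m) : D x ->
  differentiable_on D F x <->
  exists2 L : {linear 'rV[R]_m -> 'rV[R]_n}, continuous L &
    forall eps : R, 0 < eps -> \forall y \near x,
      D y -> `|F y - (F x + L (y - x))| <= eps * `|y - x|.
Proof.
move=> Dx; apply: differentiable_filterP.
have pf : ProperFilter (within D (nbhs x)).
  by apply: within_nbhs_proper; exact: subset_closure.
have h : hausdorff_space 'rV[R]_m := @norm_hausdorff _ _.
exact: (@cvg_lim _ h _ _ pf id x (@cvg_within _ (nbhs x) (nbhs_filter x) D)).
Qed.

Lemma differentiable_on_nbhs (R : realType) (m n : nat) (D : set 'rV[R]_m)
    (F : 'rV[R]_m -> 'rV[R]_n) (x : 'rV[R]_m) :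
  nbhs x D -> differentiable_on D F x <-> differentiable F x.
Proof.
move=> nDx; have Dx := nbhs_singleton nDx.
rewrite (propext (differentiable_onP F Dx)).
have h : hausdorff_space 'rV[R]_m := @norm_hausdorff _ _.
rewrite (propext (differentiable_filterP F (@lim_id _ h x))).
split=> -[L Lc FL]; exists L => // e e0; have := FL e e0.
- by apply: filterS2 nDx => y Dy; apply.
- by apply: filterS.
Qed.

Lemma local_rep_dom_nbhs (R : realType) (M N : C1manifold R) (f : M -> N)
    (x : M) (c : chart R M (dim M)) (d : chart R N (dim N)) :
  chart_at x c -> chart_at (f x) d -> {for x, continuous f} ->
  nbhs (c x) (local_rep_dom f c d).
Proof.
move=> [_ cx] [_ dfx] fx.
have fd : nbhs x (chart_dom c `&` f @^-1` chart_dom d).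
  apply: filterI; first exact: open_nbhs_nbhs (conj (chart_dom_open c) cx).
  by apply: fx; apply: open_nbhs_nbhs; split; first exact: chart_dom_open.
have img : nbhs (c x) (c @` chart_dom c).
  by apply: open_nbhs_nbhs; split; [exact: chart_img_open | exists x].
have := @chart_inv_continuous _ _ _ c.
rewrite -(chart_mapK cx) in fd.
rewrite continuous_open_subspace; last exact: chart_img_open.
have cxi : (c x \in c @` chart_dom c) by apply/mem_set; exists x.
move=> /(_ _ cxi) /(_ _ fd); apply: filterS2 img => _ [y cy <-] /=.
by rewrite chart_mapK // => -[? ?]; exists y.
Qed.

Lemma differentiable_atP (R : realType) (M N : C1manifold R) (f : M -> N)
    (x : M) : {for x, continuous f} ->
  differentiable_at f x <->
  exists c d, [/\ chart_at x c, chart_at (f x) d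
    & differentiable (local_rep f c d) (c x)].
Proof.
move=> fx; split=> -[c [d [cx dx dif]]]; exists c, d; split=> //.
- exact/(differentiable_on_nbhs _ (local_rep_dom_nbhs cx dx fx)).
- exact/(differentiable_on_nbhs _ (local_rep_dom_nbhs cx dx fx)).
Qed.

(* Main.v *)
Require Import Defs.
From mathcomp Require Import all_boot all_order all_algebra.
From mathcomp Require Import all_classical all_reals all_analysis.
From mathcomp Require Import lra ring zify.

Set Implicit Arguments.
Unset Strict Implicit.
Unset Printing Implicit Defensive.

Import Order.TTheory GRing.Theory Num.Theory.
Import numFieldNormedType.Exports.

Local Open Scope classical_set_scope.
Local Open Scope ring_scope.

(* On the torus R^n / Z^n let E_L be the mean over the dyadic grid of mesh 2^-L;
   it is invariant under grid translations, so that Garsia's proof of the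
   maximal inequality applies to it verbatim.  For a periodic Lipschitz f and an
   integer vector u, the mean square of the difference quotients
   (f (x + h u) - f x) / h increases as h = 2^-k decreases and is bounded.  Where
   it has almost stopped increasing, the fine quotients are close in mean square
   to the (slowly varying) quotient at the coarse scale, and the maximal
   inequality bounds the mean of the set where the quotients at all smaller
   scales oscillate.  A cover by dyadic cubes turns this into the existence of
   the two-sided directional derivative along u almost everywhere, without any
   measurability or Fubini argument.

   Additivity in u follows by applying this to the distance function of the set
   A where f has a given approximate slope along v: its derivative vanishes at
   almost every point of A, so that points of A are found near x + t u.  Finitely
   many integer directions then control all increments, and McShane's extension
   handles functions that are Lipschitz on a subset only. *)

(** * Null sets *)

Lemma box_volume_ge0 (R : realType) (n : nat) (a b : 'rV[R]_n) :
  (forall i, a 0 i <= b 0 i) -> 0 <= box_volume a b.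
Proof. by move=> ab; apply: prodr_ge0 => i _; rewrite subr_ge0. Qed.

Lemma lebesgue_null_sub (R : realType) (n : nat) (A B : set 'rV[R]_n) :
  A `<=` B -> lebesgue_null B -> lebesgue_null A.
Proof.
move=> AB nB e /nB[I [a [b [ab Bc le]]]].
by exists I, a, b; split=> //; exact: subset_trans Bc.
Qed.

(** Covers are built over whatever countable type is convenient and moved to [nat] along the
    injection [pickle]. Off its range both corners default to 0, which keeps them ordered. *)
Lemma esum_pickle_boxes (R : realType) (n : nat) (T : countType) (S : set T)
    (a b : T -> 'rV[R]_n) :
  (forall t, forall i, a t 0 i <= b t 0 i) ->
  exists (I : set nat) (a' b' : nat -> 'rV[R]_n),
    [/\ forall k i, a' k 0 i <= b' k 0 i,
        \bigcup_(t in S) box (a t) (b t) `<=` \bigcup_(k in I) box (a' k) (b' k)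
      & \esum_(k in I) (box_volume (a' k) (b' k))%:E
        = \esum_(t in S) (box_volume (a t) (b t))%:E].
Proof.
move=> ab.
pose g (c : T -> 'rV[R]_n) k := if unpickle k is Some t then c t else 0.
have gE c t : g c (pickle t) = c t by rewrite /g pickleK.
exists (pickle @` S), (g a), (g b); split.
- by move=> k i; rewrite /g; case: unpickle.
- move=> x [t St xt]; exists (pickle t); first by exists t.
  by rewrite !gE.
- rewrite (@reindex_esum R T nat S (pickle @` S) pickle).
    by apply: eq_esum => t _; rewrite !gE.
  split=> [t St|x y _ _|y [x Sx <-]]; [by exists t| |by exists x].
  exact: (pcan_inj pickleK).
Qed.

Lemma lebesgue_null_bigcup (R : realType) (n : nat) (T : countType)
    (A : T -> set 'rV[R]_n) :
  (forall t, lebesgue_null (A t)) -> lebesgue_null (\bigcup_t A t).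
Proof.
move=> nA e e0.
(* The shares [e / 2 ^ (k + 1)] over all [k] sum to [e], and [pickle] uses each [k] at most once. *)
have e20 (t : T) : 0 < e / (2 ^ (pickle t).+1)%:R by rewrite divr_gt0.
have /choice[q qP] t := nA t _ (e20 t).
have /choice[F FP] t : exists F : set nat * (nat -> 'rV[R]_n) * (nat -> 'rV[R]_n),
    [/\ forall k i, F.1.2 k 0 i <= F.2 k 0 i,
        A t `<=` \bigcup_(k in F.1.1) box (F.1.2 k) (F.2 k)
      & (\esum_(k in F.1.1) (box_volume (F.1.2 k) (F.2 k))%:E
         <= (e / (2 ^ (pickle t).+1)%:R)%:E)%E].
  by have [a [b ?]] := qP t; exists (q t, a, b).
have [|I0 [a [b [ab sub le]]]] := @esum_pickle_boxes R n (T * nat)%type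
  (setT `*`` (fun t => (F t).1.1)) (fun p => (F p.1).1.2 p.2)
  (fun p => (F p.1).2 p.2).
  by move=> [t k] i /=; have [h _ _] := FP t.
exists I0, a, b; split=> //.
  apply: subset_trans sub => x [t _ Atx].
  have [_ /(_ _ Atx)[k Ik xk] _] := FP t.
  by exists (t, k).
rewrite le -(@esum_esum R T nat setT (fun t => (F t).1.1)
  (fun t k => (box_volume ((F t).1.2 k) ((F t).2 k))%:E)); last first.
  move=> t k _ _; rewrite lee_fin; have [h _ _] := FP t; exact: (box_volume_ge0 (h k)).
have h0 : (forall k : nat, (0 <= (e / (2 ^ k.+1)%:R)%:E)%E).
  by move=> k; rewrite lee_fin divr_ge0// ltW.
apply: (@le_trans _ _ (\esum_(t in [set: T]) (e / (2 ^ (pickle t).+1)%:R)%:E)).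
  by apply: le_esum => t _; have [_ _] := FP t.
have pickle_bij : set_bij [set: T] (pickle @` [set: T]) pickle.
  split=> [t St|x y _ _|y [x Sx <-]]; [by exists t| |by exists x].
  exact: (pcan_inj pickleK).
have := reindex_esum _ _ _ (fun k => (e / (2 ^ k.+1)%:R)%:E) pickle_bij.
move=> /= <-.
apply: (@le_trans _ _ (\esum_(k in [set: nat]) (e / (2 ^ k.+1)%:R)%:E)).
  rewrite (esum_mkcond (pickle @` _)); apply: le_esum => k _.
  by case: ifP.
rewrite -nneseries_esumT //.
apply: le_trans (epsilon_trick0 xpredT (ltW e0)); exact: lexx.
Qed.

Lemma lebesgue_null_setU (R : realType) (n : nat) (A B : set 'rV[R]_n) :
  lebesgue_null A -> lebesgue_null B -> lebesgue_null (A `|` B).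
Proof.
move=> nA nB; apply: (@lebesgue_null_sub _ _ _
  (\bigcup_(b : bool) if b then A else B)).
  by move=> x [Ax|Bx]; [exists true|exists false].
by apply: lebesgue_null_bigcup => -[].
Qed.

Lemma lebesgue_null_translate (R : realType) (n : nat) (A : set 'rV[R]_n)
    (c : 'rV[R]_n) :
  lebesgue_null A -> lebesgue_null [set x | A (x - c)].
Proof.
move=> nA e /nA[I [a [b [ab Ac le]]]].
exists I, (fun k => a k + c), (fun k => b k + c); split.
- by move=> k i; rewrite !mxE lerD2r.
- move=> x /Ac[k Ik kx]; exists k => // i; have := kx i.
  by rewrite !mxE lerBrDr lerBlDr.
- rewrite (eq_esum (b := fun k => (box_volume (a k) (b k))%:E))// => k _.
  by congr EFin; apply: eq_bigr => i _; rewrite !mxE; ring.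
Qed.

(** A sum of nonnegative terms is the supremum of its finite subsums, so it is enough to bound
    finite families of boxes. *)
Lemma lebesgue_null_countable_cover (R : realType) (n : nat)
    (A : set 'rV[R]_n) :
  (forall eps : R, 0 < eps -> exists (T : countType) (S : set T)
     (a b : T -> 'rV[R]_n), [/\ forall t i, a t 0 i <= b t 0 i,
        A `<=` \bigcup_(t in S) box (a t) (b t)
      & forall s : seq T, uniq s -> (forall t, t \in s -> S t) ->
          \sum_(t <- s) box_volume (a t) (b t) <= eps]) ->
  lebesgue_null A.
Proof.
move=> h e e0; have [T [S [a [b [ab Ac le]]]]] := h e e0.
have [I [a' [b' [ab' sub eqe]]]] := esum_pickle_boxes S ab.
exists I, a', b'; split=> //; first exact: subset_trans sub.
rewrite eqe; apply: ge_ereal_sup => _ [F [finF FS] <-].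
rewrite fsbig_finite//= sumEFin lee_fin.
apply: le => [|t]; first exact: finmap.fset_uniq.
by rewrite in_fset_set// => /set_mem; exact: FS.
Qed.

(** * Means over dyadic grids *)

Section mean.
Context {R : realType} {n : nat}.
Implicit Types (f g h : 'rV[R]_n -> R) (x y : 'rV[R]_n) (z : 'rV[int]_n).

Definition int_vec z : 'rV[R]_n := \row_i (z 0 i)%:~R.

Definition zperiodic f := forall z x, f (x + int_vec z) = f x.

Definition dyadic (L : nat) : R := (2 ^+ L)^-1.

Definition grid (L : nat) := {ffun 'I_n -> 'I_(2 ^ L)}.

Definition grid_pt L (c : grid L) : 'rV[R]_n := \row_i ((c i)%:R * dyadic L).

Definition mean L f : R :=
  #|{: grid L}|%:R^-1 * \sum_(c : grid L) f (grid_pt c).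

Lemma dyadic_gt0 L : 0 < dyadic L.
Proof. by rewrite invr_gt0 exprn_gt0. Qed.

Lemma dyadic_ge0 L : 0 <= dyadic L. Proof. exact/ltW/dyadic_gt0. Qed.

Lemma dyadicD k l : dyadic k = (2 ^ l)%:R * dyadic (k + l).
Proof.
by rewrite /dyadic exprD natrX invfM mulrCA mulfV ?mulr1// expf_neq0// pnatr_eq0.
Qed.

Lemma card_grid L : #|{: grid L}| = ((2 ^ L) ^ n)%N.
Proof. by rewrite card_ffun !card_ord. Qed.

Lemma card_grid_gt0 L : 0 < #|{: grid L}|%:R :> R.
Proof. by rewrite ltr0n card_grid !expn_gt0. Qed.

Lemma int_vecD z1 z2 : int_vec (z1 + z2) = int_vec z1 + int_vec z2.
Proof. by apply/rowP => i; rewrite !mxE intrD. Qed.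

Lemma int_vecN z : int_vec (- z) = - int_vec z.
Proof. by apply/rowP => i; rewrite !mxE mulrNz. Qed.

Lemma int_vecMn z m : int_vec (z *+ m) = m%:R *: int_vec z.
Proof.
by apply/rowP => i; rewrite !mxE mulmxnE rmorphMn mulr_natl.
Qed.

Lemma eq_mean L f g : f =1 g -> mean L f = mean L g.
Proof. by move=> fg; congr (_ * _); apply: eq_bigr => c _; rewrite fg. Qed.

Lemma mean_le L f g : (forall x, f x <= g x) -> mean L f <= mean L g.
Proof.
move=> fg; rewrite ler_pM2l ?invr_gt0 ?card_grid_gt0//.
by apply: ler_sum => c _; exact: fg.
Qed.

Lemma mean_cst L (a : R) : mean L (fun=> a) = a.
Proof.
rewrite /mean sumr_const -[a *+ _]mulr_natl mulrA mulVf ?mul1r//.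
by rewrite gt_eqF// card_grid_gt0.
Qed.

Lemma meanD L f g : mean L (fun x => f x + g x) = mean L f + mean L g.
Proof. by rewrite /mean big_split/= mulrDr. Qed.

Lemma meanZ L (a : R) f : mean L (fun x => a * f x) = a * mean L f.
Proof. by rewrite /mean -mulr_sumr mulrCA. Qed.

Lemma meanB L f g : mean L (fun x => f x - g x) = mean L f - mean L g.
Proof. by rewrite /mean sumrB/= mulrBr. Qed.

Lemma mean_sum L (I : Type) (r : seq I) (F : I -> 'rV[R]_n -> R) :
  mean L (fun x => \sum_(i <- r) F i x) = \sum_(i <- r) mean L (F i).
Proof.
elim: r => [|i r ih].
  by under eq_mean do rewrite big_nil; rewrite mean_cst big_nil.
by under eq_mean do rewrite big_cons; rewrite meanD ih big_cons.
Qed.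

(** Translation by a grid vector permutes the grid modulo 1; periodicity absorbs the integer
    quotients. *)
Lemma mean_shift L z f : zperiodic f ->
  mean L (fun x => f (x + dyadic L *: int_vec z)) = mean L f.
Proof.
move=> fper; rewrite /mean; congr (_ * _).
pose N : int := (2 ^ L)%N%:Z.
have N0 : N != 0 by rewrite /N eqz_nat -lt0n expn_gt0.
have hP (c : grid L) i : (`|((c i)%:Z + z 0 i)%R %% N|%Z < 2 ^ L)%N.
  by rewrite -ltz_nat gez0_abs ?modz_ge0// ltz_pmod// /N ltz_nat expn_gt0.
pose s (c : grid L) : grid L := [ffun i => Ordinal (hP c i)].
have s_inj : injective s.
  move=> c d /ffunP scd; apply/ffunP => i; apply/val_inj/eqP.
  have := scd i; rewrite !ffunE => /(congr1 val)/= /(congr1 Posz).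
  rewrite !gez0_abs ?modz_ge0// => /eqP; rewrite eqz_modDr => /eqP.
  by rewrite !modz_small ?ltz_nat ?ltn_ord// => -[->].
rewrite [RHS](reindex_inj s_inj); apply: eq_bigr => c _.
rewrite -[RHS](fper (\row_i (((c i)%:Z + z 0 i)%R %/ N)%Z)); congr f.
apply/rowP => i; rewrite !mxE !ffunE/= natr_absz ger0_norm ?modz_ge0//.
have := divz_eq ((c i)%:Z + z 0 i) N.
move: (_ %/ N)%Z (_ %% N)%Z => q r /(congr1 (fun k : int => k%:~R : R)).
rewrite !intrD intrM -[((c i)%:Z)%:~R]pmulrn => E.
have dN : N%:~R * dyadic L = 1 :> R.
  by rewrite /dyadic /N -pmulrn natrX mulfV// expf_neq0// pnatr_eq0.
by rewrite [dyadic L * _]mulrC -mulrDl E mulrDl -mulrA dN mulr1 addrC.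
Qed.

Lemma refine_proof l k (d : 'I_(2 ^ l)) (r : 'I_(2 ^ k)) :
  (d * 2 ^ k + r < 2 ^ (l + k))%N.
Proof.
rewrite expnD (@leq_trans (d.+1 * 2 ^ k))//; first by rewrite mulSn addnC ltn_add2r.
by rewrite leq_mul2r ltn_ord orbT.
Qed.

Definition refine l k (d : grid l) (r : grid k) : grid (l + k) :=
  [ffun i => Ordinal (refine_proof (d i) (r i))].

(** Every coarse grid point has the same number of refinements, and [refine] enumerates the fine
    grid bijectively. *)
Lemma mean_refine l k f :
  (forall (d : grid l) (r : grid k), f (grid_pt (refine d r)) = f (grid_pt d)) ->
  mean (l + k) f = mean l f.
Proof.
move=> fE.
pose h (p : grid l * grid k) : grid (l + k) := refine p.1 p.2.
have h_inj : injective h.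
  move=> [d r] [d' r'] /ffunP hE; congr (_, _); apply/ffunP => i; apply/val_inj.
    have := hE i; rewrite !ffunE => /(congr1 val)/= /(congr1 (divn^~ (2 ^ k)%N)).
    by rewrite !divnMDl ?expn_gt0// !divn_small ?addn0.
  have := hE i; rewrite !ffunE => /(congr1 val)/= /(congr1 (modn^~ (2 ^ k)%N)).
  by rewrite !modnMDl !modn_small.
have h_bij : bijective h.
  apply: inj_card_bij => //.
  by rewrite card_prod !card_grid expnD expnMn.
rewrite /mean [X in _ * X](reindex h)/=; last exact: onW_bij.
have -> : \sum_p f (grid_pt (h p))
    = \sum_(d : grid l) \sum_(r : grid k) f (grid_pt d).
  by rewrite pair_bigA/=; apply: eq_bigr => -[d r] _; exact: fE.
under eq_bigr => d _ do rewrite sumr_const -[_ *+ _]mulr_natl.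
rewrite -mulr_sumr mulrA !card_grid expnD expnMn natrM invfM mulfVK//.
Qed.

End mean.

(** * The maximal inequality for grid translations *)

Section maximal.
Context {R : realType} {n : nat}.
Implicit Types (f g : 'rV[R]_n -> R) (w x : 'rV[R]_n) (z : 'rV[int]_n).

(* [max_sum g w M x] is the maximum over m <= M of the sums of g over the first
   m points of the orbit x, x + w, x + 2w, ... *)
Fixpoint max_sum g w (M : nat) x : R :=
  if M is M'.+1 then Num.max 0 (g x + max_sum g w M' (x + w)) else 0.

Lemma max_sum_ge0 g w M x : 0 <= max_sum g w M x.
Proof. by case: M => //= M; rewrite le_max lexx. Qed.

Lemma max_sum_leS g w M x : max_sum g w M x <= max_sum g w M.+1 x.
Proof.
elim: M x => [|M ih] x; first exact: (max_sum_ge0 g w 1).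
by apply: le_max2 => //; rewrite lerD2l ih.
Qed.

Lemma ler_max_sum g w m M x : (m <= M)%N ->
  \sum_(j < m) g (x + j%:R *: w) <= max_sum g w M x.
Proof.
elim: m M x => [|m ih] [|M] x // mM; rewrite ?big_ord0 ?max_sum_ge0//.
rewrite big_ord_recl scale0r addr0 /= le_max lerD2l; apply/orP; right.
apply: le_trans (ih M (x + w) mM); rewrite le_eqVlt; apply/orP; left.
apply/eqP/eq_bigr => j _.
by rewrite -addrA; congr (g (x + _)); rewrite -natr1 scalerDl scale1r addrC.
Qed.

Lemma periodic_max_sum g w M : zperiodic g -> zperiodic (max_sum g w M).
Proof.
move=> gper; elim: M => [|M ih] z x //=.
by rewrite gper [x + _ + w]addrAC ih.
Qed.

(* Garsia's argument: where F := max_sum g w M is positive,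
   F x <= g x + F (x + w), and F has the same mean as its translate. *)
Lemma mean_max_sum_gt0 L z g M : zperiodic g ->
  0 <= mean L (fun x =>
    (0 < max_sum g (dyadic L *: int_vec z) M x)%R%:R * g x).
Proof.
set w := _ *: _ => gper; have Fper := periodic_max_sum w M gper.
have E : mean L (fun x => max_sum g w M x - max_sum g w M (x + w)) = 0.
  by rewrite meanB mean_shift ?subrr.
rewrite -[leLHS]E {E}.
apply: mean_le => x /=; rewrite -/w.
case: ltP => F0; last first.
  rewrite mul0r subr_le0. exact: le_trans F0 (max_sum_ge0 _ _ _ _).
have := lt_le_trans F0 (max_sum_leS g w M x); have := max_sum_leS g w M x.
rewrite /= lt_max ltxx /= => + gF; rewrite (max_r (ltW gF)) mul1r.
by rewrite lerBlDr.
Qed.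

(** Garsia's inequality is applied to [g - a]: at a point of [P] some partial sum of [g - a] along
    the orbit is positive, hence so is its [max_sum]. *)
Lemma mean_maximal L z g M (a : R) (P : set 'rV[R]_n) :
  let w := dyadic L *: int_vec z in
  zperiodic g -> (forall x, 0 <= g x) -> 0 < a ->
  (forall x, P x -> exists2 m : nat, (0 < m <= M)%N &
      a * m%:R < \sum_(j < m) g (x + j%:R *: w)) ->
  a * mean L \1_P <= mean L g.
Proof.
move=> w gper g0 a0 Pg; pose k x := g x - a.
have kper : zperiodic k by move=> y x; rewrite /k gper.
have /= := mean_max_sum_gt0 L z M kper; rewrite -/w.
set I := fun x => (0 < max_sum k w M x)%R%:R : R.
have -> : mean L (fun x => I x * k x) =
    mean L (fun x => I x * g x) - a * mean L I.
  by rewrite -meanZ -meanB; apply: eq_mean => x; rewrite /k /=; ring.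
rewrite subr_ge0 => aI; apply: (@le_trans _ _ (a * mean L I)).
  rewrite ler_pM2l//; apply: mean_le => x; rewrite indicE ler_nat.
  case: (boolP (x \in P)) => // /set_mem/Pg[m /andP[m0 mM] agt].
  have -> // : 0 < max_sum k w M x.
  apply: lt_le_trans (ler_max_sum k w x mM).
  by rewrite /k sumrB sumr_const card_ord subr_gt0 -mulr_natr.
apply: le_trans aI _; apply: mean_le => x.
by rewrite /I; case: ltP; rewrite ?mul1r ?mul0r.
Qed.

End maximal.

(** * Energy of difference quotients *)

(** The variance identity, [A] being the average of the [a j]. *)
Lemma sum_sqr_dev (R : numFieldType) (m : nat) (a : nat -> R) (A : R) :
  \sum_(j < m) a j = m%:R * A ->
  \sum_(j < m) (a j - A) ^+ 2 = \sum_(j < m) a j ^+ 2 - m%:R * A ^+ 2.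
Proof.
move=> aA; under eq_bigr do rewrite sqrrB.
rewrite big_split/= sumrB sumrMnl -mulr_suml aA sumr_const card_ord.
by rewrite -mulr_natl; ring.
Qed.

Lemma exists_le_avg (R : realDomainType) (m : nat) (a : nat -> R) (A : R) :
  (0 < m)%N -> \sum_(j < m) a j = m%:R * A -> exists2 j, (j < m)%N & a j <= A.
Proof.
move=> m0 aA; apply: contrapT => no.
have /= := @ltr_sum_nat R 0 m (fun=> A) a m0.
rewrite big_mkord [X in _ < X]big_mkord aA sumr_const card_ord mulr_natl ltxx.
move=> h; suff : false by []; apply: h => j /= jm; rewrite ltNge; apply/negP => ajA; apply: no; exists j => //.
Qed.

Section energy.
Context {R : realType} {n : nat}.
Implicit Types (f g : 'rV[R]_n -> R) (u x y : 'rV[R]_n) (z : 'rV[int]_n).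

Definition lip (C : R) f := forall x y, `|f x - f y| <= C * `|x - y|.

(** Negative [h] is allowed, so that limits of these quotients are two-sided; at [h = 0] the value
    is 0. *)
Definition dq f u (h : R) x : R := (f (x + h *: u) - f x) / h.

(** The increments over consecutive steps telescope, so a coarse quotient is the average of the fine
    ones along the segment. *)
Lemma dq_avg f u (h : R) (m : nat) x : h != 0 ->
  \sum_(j < m) dq f u h (x + (j%:R * h) *: u) = m%:R * dq f u (m%:R * h) x.
Proof.
move=> h0; case: m => [|m]; first by rewrite big_ord0 mul0r.
have -> : m.+1%:R * dq f u (m.+1%:R * h) x = (f (x + (m.+1%:R * h) *: u) - f x) / h.
  have : m.+1%:R != 0 :> R by rewrite pnatr_eq0.
  by rewrite /dq; move: (m.+1%:R : R) => N N0; field; rewrite h0.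
rewrite -mulr_suml; congr (_ * _).
rewrite -(big_mkord xpredT (fun j => f (x + (j%:R * h) *: u + h *: u)
  - f (x + (j%:R * h) *: u))).
rewrite (telescope_sumr_eq (fun j => f (x + (j%:R * h) *: u)))//.
  by rewrite mul0r scale0r addr0.
by move=> j _; rewrite -addrA -scalerDl -[j.+1%:R]natr1 mulrDl mul1r.
Qed.


Lemma zperiodic_shift f c : zperiodic f -> zperiodic (fun x => f (x + c)).
Proof. by move=> fper z x; rewrite addrAC fper. Qed.

Lemma zperiodic_dq f u h : zperiodic f -> zperiodic (dq f u h).
Proof. by move=> fper z x; rewrite /dq addrAC !fper. Qed.

Lemma dyadic_int_vec k e (j : nat) z :
  (j%:R * dyadic k) *: int_vec z
  = dyadic (k + e) *: int_vec (z *+ (j * 2 ^ e)) :> 'rV[R]_n.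
Proof.
by rewrite (dyadicD k e) int_vecMn scalerA natrM; congr (_ *: _); ring.
Qed.

Lemma mean_dyadic_shift k L (j : nat) z g : (k <= L)%N -> zperiodic g ->
  mean L (fun x => g (x + (j%:R * dyadic k) *: int_vec z)) = mean L g.
Proof.
move=> /subnKC <- gper; rewrite -[RHS](mean_shift _ (z *+ (j * 2 ^ (L - k)))) //.
by under eq_mean do rewrite (@dyadic_int_vec k (L - k)).
Qed.

Lemma lip_ge0 C f : lip C f -> forall x y, 0 <= C * `|x - y|.
Proof. by move=> fC x y; exact: le_trans (fC x y). Qed.

Lemma dq_le C f u h x : lip C f -> `|dq f u h x| <= C * `|u|.
Proof.
move=> fC; have [->|h0] := eqVneq h 0.
  by rewrite /dq invr0 mulr0 normr0; have := lip_ge0 fC u 0; rewrite subr0.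
rewrite normrM normfV ler_pdivrMr ?normr_gt0//.
by rewrite (le_trans (fC _ _))// addrC addKr normrZ -mulrA [`|u| * _]mulrC.
Qed.

Lemma dq_lip C f u h x y : lip C f ->
  `|dq f u h x - dq f u h y| <= 2 * C * `|x - y| / `|h|.
Proof.
move=> fC; rewrite /dq -mulrBl normrM normfV ler_wpM2r ?invr_ge0//.
have -> : f (x + h *: u) - f x - (f (y + h *: u) - f y) =
  (f (x + h *: u) - f (y + h *: u)) - (f x - f y) by ring.
rewrite (le_trans (ler_normB _ _))// -mulrA mulr_natl mulr2n lerD ?fC//.
by have := fC (x + h *: u) (y + h *: u); rewrite opprD addrACA subrr addr0.
Qed.

Definition dq_energy f z L k := mean L (fun x => dq f (int_vec z) (dyadic k) x ^+ 2).

Lemma dq_energy_ge0 f z L k : 0 <= dq_energy f z L k.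
Proof. by rewrite -[leLHS](@mean_cst R n L); apply: mean_le => x; exact: sqr_ge0. Qed.

Lemma dq_energy_le C f z L k : lip C f ->
  dq_energy f z L k <= (C * `|int_vec z : 'rV[R]_n|) ^+ 2.
Proof.
move=> fC; rewrite -[leRHS](@mean_cst R n L); apply: mean_le => x.
by rewrite -[leLHS]real_normK ?num_real// lerXn2r ?nnegrE ?dq_le// (le_trans _ (dq_le (int_vec z) 1 x fC)).
Qed.

(** By [dq_avg] the coarse quotient is the average of [2 ^ d] fine ones, so the variance identity
    turns mean square deviations into a difference of energies. *)
Lemma dq_energy_var f z L K d : zperiodic f -> (K + d <= L)%N ->
  let u := int_vec z in let de := dyadic (K + d) in
  \sum_(j < 2 ^ d) mean L (fun x =>
     (dq f u de x - dq f u (dyadic K) (x - (j%:R * de) *: u)) ^+ 2)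
  = (2 ^ d)%:R * (dq_energy f z L (K + d) - dq_energy f z L K).
Proof.
move=> fper KdL u de; have de0 : de != 0 by rewrite gt_eqF// dyadic_gt0.
pose G j x := (dq f u de x - dq f u (dyadic K) (x - (j%:R * de) *: u)) ^+ 2.
have Gper j : zperiodic (G j).
  by move=> y x; rewrite /G [_ - _ *: u]addrAC !zperiodic_dq.
(* Translating the [j]-th term by [j de u] leaves its mean unchanged and gives all terms the same
   coarse quotient, based at [x]. *)
rewrite (eq_bigr (fun j : 'I__ => mean L (fun x =>
    (dq f u de (x + (j%:R * de) *: u) - dq f u (dyadic K) x) ^+ 2))); last first.
  move=> j _; rewrite -(mean_dyadic_shift j z KdL (Gper j)).
  by apply: eq_mean => x; rewrite /G addrK.
rewrite -mean_sum.
under eq_mean => x.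
  rewrite (@sum_sqr_dev _ _ (fun j => dq f u de (x + (j%:R * de) *: u))); last first.
    by rewrite dq_avg// [X in dq _ _ X](_ : _ = dyadic K) // [RHS](dyadicD K d).
  over.
rewrite meanB meanZ mean_sum mulrBr; congr (_ - _).
rewrite (eq_bigr (fun=> dq_energy f z L (K + d))); last first.
  move=> j _; rewrite (mean_dyadic_shift (g := fun x => dq f u de x ^+ 2) j z KdL)//.
  by move=> y x; rewrite zperiodic_dq.
by rewrite sumr_const card_ord mulr_natl.
Qed.

(** If every [K] failed, the energy would gain [eta] again and again although it is bounded. Since
    [K] comes before [d] and [L0], the radius in [mean_oscillates] can be fixed before the cutoff
    [rho]. *)
Lemma dq_energy_gap C f z (eta : R) : lip C f -> 0 < eta ->
  exists K, forall d L0, exists L,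
    [/\ (L0 <= L)%N, (K + d <= L)%N
      & dq_energy f z L (K + d) - dq_energy f z L K <= eta].
Proof.
move=> fC eta0; apply: contrapT => no.
have step K : exists d L0, forall L, (L0 <= L)%N ->
    eta + dq_energy f z L K <= dq_energy f z L (K + d).
  apply: contrapT => h; apply: no; exists K => d L0; apply: contrapT => h'.
  apply: h; exists d, (L0 + (K + d))%N => L LL; rewrite leNgt; apply/negP => lt.
  apply: h'; exists L; split; [lia|lia|].
  by rewrite lerBlDr ltW.
have {}step i : exists K L0, forall L, (L0 <= L)%N ->
    eta * i%:R <= dq_energy f z L K.
  elim: i => [|i [K [L0 ih]]].
    by exists 0%N, 0%N => L _; rewrite mulr0 dq_energy_ge0.
  have [d [L1 h]] := step K; exists (K + d)%N, (L0 + L1)%N => L LL.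
  apply: le_trans (h L _); last lia.
  by rewrite -natr1 mulrDr mulr1 addrC lerD2l ih//; lia.
(* After this many gains of [eta] the energy exceeds the bound of [dq_energy_le]. *)
have [K [L0 h]] := step (Num.truncn ((C * `|int_vec z : 'rV[R]_n|) ^+ 2 / eta)).+1.
have := le_trans (h _ (leqnn _)) (dq_energy_le z L0 K fC).
apply/negP; rewrite -ltNge [ltRHS]mulrC -ltr_pdivrMr//.
by rewrite truncnS_gt.
Qed.

End energy.

(** * Oscillation of difference quotients across scales *)

Section oscillation.
Context {R : realType} {n : nat}.
Implicit Types (f g : 'rV[R]_n -> R) (u x y : 'rV[R]_n) (z : 'rV[int]_n).

(** The lower cutoff [rho] makes the condition stable under small displacements of the point and
    lets it be tested with steps of a fixed fine scale. *)
Definition oscillates f u (eps r rho : R) : set 'rV[R]_n :=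
  [set x | exists t t', [/\ rho <= `|t| <= r, rho <= `|t'| <= r
    & eps < `|dq f u t x - dq f u t' x|]].

Lemma dyadic_small (a : R) : 0 < a -> exists d, dyadic d <= a.
Proof.
move=> a0; exists (Num.truncn a^-1).+1.
rewrite -[leRHS]invrK /dyadic lef_pV2 ?posrE ?invr_gt0 ?exprn_gt0//.
apply: le_trans (ltW (truncnS_gt _)) _.
by rewrite -natrX ler_nat ltnW// ltn_expl.
Qed.

Lemma dyadic_leD d k : dyadic (k + d) <= dyadic d :> R.
Proof.
rewrite [leRHS](dyadicD d k) addnC ler_peMl ?dyadic_ge0//.
by rewrite ler1n expn_gt0.
Qed.

(* AM-GM: [|p| <= e / 2 + p ^ 2 / (2 e)]. *)
Lemma sum_near_cst (m : nat) (b p : nat -> R) (c e : R) : 0 < e ->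
  (forall i, (i < m)%N -> `|b i - c| <= `|p i| + e) ->
  \sum_(i < m) p i ^+ 2 <= e ^+ 2 * m%:R ->
  `|\sum_(i < m) b i - m%:R * c| <= 2 * e * m%:R.
Proof.
move=> e0 bc pe.
have amgm (q : R) : `|q| <= e / 2 + q ^+ 2 / (2 * e).
  have : 0 <= (`|q| - e) ^+ 2 / (2 * e).
    by rewrite divr_ge0 ?sqr_ge0// mulr_ge0// ltW.
  rewrite sqrrB real_normK ?num_real//.
  set k := `|q|.
  have -> : (q ^+ 2 - k * e *+ 2 + e ^+ 2) / (2 * e)
    = q ^+ 2 / (2 * e) - k + e / 2 by field; rewrite gt_eqF.
  lra.
have -> : m%:R * c = \sum_(i < m) c by rewrite sumr_const card_ord mulr_natl.
rewrite -sumrB.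
apply: le_trans (ler_norm_sum _ _ _) _.
apply: (@le_trans _ _ (\sum_(i < m) (3 / 2 * e + p i ^+ 2 / (2 * e)))).
  by apply: ler_sum => i _; have := bc i (ltn_ord i); have := amgm (p i); lra.
rewrite big_split/= sumr_const card_ord -mulr_suml.
have : (\sum_(i < m) p i ^+ 2) / (2 * e) <= e ^+ 2 * m%:R / (2 * e).
  by rewrite ler_pM2r// invr_gt0 mulr_gt0.
have -> : e ^+ 2 * m%:R / (2 * e) = e / 2 * m%:R by field; rewrite gt_eqF.
move: (_ / (2 * e)) => T Te; rewrite -[_ *+ m]mulr_natr.
have -> : 2 * e * m%:R = 3 / 2 * e * m%:R + e / 2 * m%:R by field.
by rewrite lerD2l.
Qed.

(* [psi + ref] splits the difference quotients at the fine scale [|s|] into a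
   part with small quadratic averages and a slowly varying part [ref]. *)
Lemma dq_near_ref f u (C B e r t s : R) (m : nat) x (a : nat -> 'rV[R]_n)
    (psi ref : 'rV[R]_n -> R) :
  lip C f -> C * `|u| <= B -> 0 < e -> s != 0 -> (0 < m)%N ->
  (forall i, dq f u s (x + (i%:R * s) *: u) = psi (a i) + ref (a i)) ->
  (forall i, (i < m)%N -> `|ref (a i) - ref x| <= e) ->
  \sum_(i < m) psi (a i) ^+ 2 <= e ^+ 2 * m%:R ->
  `|ref x| <= B ->
  `|m%:R * s| <= `|t| -> `|t - m%:R * s| <= `|s| -> 2 * B * `|s| <= e * `|t| ->
  `|dq f u t x - ref x| <= 3 * e.
Proof.
move=> fC CB e0 s0 m0 dqE refe psie refB mst tms Bs.
have m0' : 0 < m%:R :> R by rewrite ltr0n.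
have t0 : 0 < `|t|.
  by apply: lt_le_trans mst; rewrite normr_gt0 mulf_neq0// gt_eqF.
have tn0 : t != 0 by rewrite -normr_gt0.
have avg : `|dq f u (m%:R * s) x - ref x| <= 2 * e.
  rewrite -(ler_pM2l m0') -{1}(gtr0_norm m0') -normrM mulrBr -dq_avg// [leRHS]mulrC.
  apply: (@sum_near_cst m (fun i => dq f u s (x + (i%:R * s) *: u))
    (fun i => psi (a i))) => // i im.
  rewrite dqE -addrA (le_trans (ler_normD _ _))// lerD2l; exact: refe.
rewrite -(ler_pM2l t0) -normrM.
(* The increment over [t] is split at [m s]. The remainder has length at most [|s|] and costs
   [2 B |s|], which is at most [e |t|]. *)
have -> : t * (dq f u t x - ref x) =
   (f (x + t *: u) - f (x + (m%:R * s) *: u))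
   + (m%:R * s) * (dq f u (m%:R * s) x - ref x) - (t - m%:R * s) * ref x.
  rewrite /dq; set T := m%:R * s.
  have T0 : T != 0 by rewrite mulf_neq0// gt_eqF.
  by field; rewrite tn0 T0.
have h1 : `|f (x + t *: u) - f (x + (m%:R * s) *: u)| <= B * `|s|.
  apply: le_trans (fC _ _) _.
  rewrite opprD addrACA subrr add0r -scalerBl normrZ mulrCA mulrC.
  by apply: ler_pM => //; rewrite -?normrZ ?(le_trans _ (dq_le u 1 x fC)).
have h2 : `|(m%:R * s) * (dq f u (m%:R * s) x - ref x)| <= `|t| * (2 * e).
  by rewrite normrM ler_pM.
have h3 : `|(t - m%:R * s) * ref x| <= B * `|s|.
  by rewrite normrM mulrC ler_pM.
apply: le_trans (ler_normB _ _) _; apply: le_trans (lerD (ler_normD _ _) h3) _.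
lra.
Qed.

End oscillation.

Section main_estimate.
Context {R : realType} {n : nat}.
Implicit Types (f g : 'rV[R]_n -> R) (u x y : 'rV[R]_n) (z : 'rV[int]_n).

(* The reference slope [ref] is the difference quotient at a coarse scale h: at
   the right scale the energy hardly increases on refinement, so that the fine
   quotients are close to [ref] in mean square, hence, by the maximal inequality
   in both directions, in average along most orbits. *)
Lemma mean_oscillates C f z (eps eta : R) : zperiodic f -> lip C f ->
  0 < eps -> 0 < eta ->
  exists2 r, 0 < r & forall rho L0, 0 < rho -> exists2 L, (L0 <= L)%N &
    mean L \1_(oscillates f (int_vec z) eps r rho) <= eta.
Proof.
move=> fper fC eps0 eta0; set u : 'rV[R]_n := int_vec z.
pose B := C * `|u| + 1.
have Cu0 : 0 <= C * `|u| by have := lip_ge0 fC u 0; rewrite subr0.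
have B0 : 0 < B by rewrite ltr_wpDl.
have CB : C * `|u| <= B by rewrite lerDl.
(* Off the exceptional sets both quotients will lie within [3 e] of [ref x], hence within [eps] of
   each other. *)
pose e := eps / 6.
have e0 : 0 < e by rewrite divr_gt0.
(* The maximal inequality at level [e ^ 2] bounds each of the two exceptional sets, forward and
   backward, by [eta / 2]. *)
pose eta1 := eta * e ^+ 2 / 2.
have eta10 : 0 < eta1 by rewrite divr_gt0// mulr_gt0// exprn_gt0.
have [K gap] := dq_energy_gap z fC eta10.
pose h : R := dyadic K; have h0 : 0 < h := dyadic_gt0 K.
(* By [dq_lip] a quotient at scale [h] changes by at most [e] under a displacement of length
   [r |u|]. *)
pose r := e * h / (2 * B).
have r0 : 0 < r by rewrite divr_gt0 ?mulr_gt0.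
exists r => // rho L0 rho0.
(* The first bound makes at least one step [de] fit into any scale above [rho]; the second makes the
   rounding to a multiple of [de] cost at most [e] times that scale. *)
have [d dle] : exists d, dyadic d <= Num.min rho (e * rho / (2 * B)).
  by apply: dyadic_small; rewrite lt_min rho0/= divr_gt0 ?mulr_gt0.
pose de : R := dyadic (K + d); have de0 : 0 < de := dyadic_gt0 _.
have {dle} : de <= Num.min rho (e * rho / (2 * B)) := le_trans (dyadic_leD d K) dle.
rewrite le_min ler_pdivlMr ?mulr_gt0// => /andP[de_rho de_e].
have [L [L0L KdL gapL]] := gap d L0; exists L => //.
have d0 : (0 < 2 ^ d)%N by rewrite expn_gt0.
have /= var := dq_energy_var z fper KdL.
(* Some offset [j] does no worse than the average, which is the energy gap; it fixes the base point
   of [ref]. *)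
have [j jd psij] := exists_le_avg (a := fun j => mean L (fun x =>
  (dq f u de x - dq f u h (x - (j%:R * de) *: u)) ^+ 2)) d0 var.
pose ref x := dq f u h (x - (j%:R * de) *: u).
pose psi x := dq f u de x - ref x.
pose g x := psi x ^+ 2.
have gper : zperiodic g.
  by move=> y x; rewrite /g /psi /ref [_ - _ *: u]addrAC !zperiodic_dq.
have {psij gapL}mg : mean L g <= eta1 := le_trans psij gapL.
(* A step [de u] is rewritten as a translation of the grid of mesh [2^-L]. *)
pose zde := z *+ (1 * 2 ^ (L - (K + d))).
pose w : 'rV[R]_n := dyadic L *: int_vec zde.
have wE : w = de *: u.
  rewrite /w -[de]mul1r (@dyadic_int_vec R n (K + d) (L - (K + d)) 1 z).
  by rewrite subnKC.
(* For negative [t] the orbit runs backward, and the quotient with step [- de] at a point is the one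
   with step [de] based one step earlier; hence the shift. *)
pose g' x := g (x - w).
have g'per : zperiodic g' by exact: zperiodic_shift.
have mg' : mean L g' = mean L g.
  rewrite -[RHS](mean_shift L (- zde)) //.
  by apply: eq_mean => x; rewrite /g' /w int_vecN scalerN.
pose M := Num.truncn (r / de).
pose P v (k : 'rV[R]_n -> R) := [set x | exists2 m, (0 < m <= M)%N &
   e ^+ 2 * m%:R < \sum_(i < m) k (x + i%:R *: v)].
have mP1 : e ^+ 2 * mean L \1_(P w g) <= eta1.
  apply: le_trans mg; apply: (mean_maximal (z := zde) (M := M) gper).
  - by move=> x; exact: sqr_ge0.
  - by rewrite exprn_gt0.
  - by move=> x [m ? ?]; exists m.
have mP2 : e ^+ 2 * mean L \1_(P (- w) g') <= eta1.
  rewrite -mg' in mg; apply: le_trans mg; rewrite /w -scalerN -int_vecN.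
  apply: (mean_maximal (z := - zde) (M := M) g'per).
  - by move=> x; exact: sqr_ge0.
  - by rewrite exprn_gt0.
  - by move=> x [m ? ?]; exists m.
suff sub : oscillates f u eps r rho `<=` P w g `|` P (- w) g'.
  apply: (@le_trans _ _ (mean L \1_(P w g) + mean L \1_(P (- w) g'))).
    rewrite -meanD; apply: mean_le => x; rewrite !indicE -natrD ler_nat.
    case: (boolP (x \in oscillates _ _ _ _ _)) => // /set_mem/sub[] /mem_set ->//.
    by rewrite addn1.
  have e20 : 0 < e ^+ 2 by rewrite exprn_gt0.
  rewrite -(ler_pM2l e20) mulrDr (le_trans (lerD mP1 mP2))//.
  by rewrite /eta1 -splitr mulrC.
move=> x [t [t' [tr t'r osc]]]; apply: contrapT => /not_orP[nP1 nP2].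
have refB y : `|ref y| <= B by apply: le_trans CB; exact: dq_le.
have ref_near y c : `|y - x| <= c * `|u| -> 0 <= c <= r -> `|ref y - ref x| <= e.
  move=> yx /andP[c0 cr]; apply: le_trans (dq_lip _ _ _ _ fC) _.
  rewrite opprD addrACA subrr addr0 (gtr0_norm h0) ler_pdivrMr//.
  have Cyx : C * `|y - x| <= c * B.
    have [C0|C0] := leP 0 C.
      apply: le_trans (ler_wpM2l C0 yx) _.
      by rewrite mulrCA ler_wpM2l.
    apply: le_trans (mulr_ge0 c0 (ltW B0)).
    by rewrite nmulr_rle0.
  have rB : r * B = e * h / 2 by rewrite /r; field; rewrite gt_eqF.
  have := ler_wpM2r (ltW B0) cr; lra.
have near s : rho <= `|s| <= r -> `|dq f u s x - ref x| <= 3 * e.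
  move=> /andP[rhos sr].
  pose m := Num.truncn (`|s| / de).
  have sde : 0 <= `|s| / de by rewrite divr_ge0// ltW.
  have m0 : (0 < m)%N by rewrite truncn_gt0 ler_pdivlMr// mul1r (le_trans de_rho).
  have mM : (m <= M)%N by apply: le_truncn; rewrite ler_pM2r// invr_gt0.
  have /andP[ms sm] := truncn_itv sde; rewrite -/m in ms sm.
  rewrite ler_pdivlMr// in ms; rewrite ltr_pdivrMr// in sm.
  have mde : 0 <= m%:R * de by rewrite mulr_ge0// ltW.
  have msr : m%:R * de <= r := le_trans ms sr.
  have B2 : 2 * B * de <= e * `|s|.
    by rewrite mulrC (le_trans de_e)// ler_pM2l.
  have [s0|s0] := leP 0 s.
    apply: (@dq_near_ref _ _ f u C B e r s de m x
      (fun i => x + (i%:R * de) *: u) psi ref) => //.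
    - by rewrite gt_eqF.
    - by move=> i; rewrite /psi subrK.
    - move=> i im; apply: (ref_near _ (i%:R * de)).
        by rewrite addrC addKr normrZ ger0_norm// mulr_ge0// ltW.
      by rewrite mulr_ge0 ?(ltW de0)//= (le_trans _ msr)// ler_wpM2r ?ler_nat ?(ltnW im)// ltW.
    - rewrite leNgt; apply/negP => lt; apply: nP1; exists m; first by rewrite m0.
      apply: lt_le_trans lt _; apply: ler_sum => i _.
      by rewrite /g wE scalerA.
    - by rewrite ger0_norm.
    - by move: ms sm; rewrite (ger0_norm s0) (gtr0_norm de0) -natr1 ler_norml; lra.
    - by rewrite (gtr0_norm de0).
  apply: (@dq_near_ref _ _ f u C B e r s (- de) m x
      (fun i => x - de *: u - (i%:R * de) *: u) psi ref) => //.
  - by rewrite oppr_eq0 gt_eqF.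
  - move=> i; rewrite /psi subrK /dq mulrN scaleNr.
    have -> : x - de *: u - (i%:R * de) *: u + de *: u = x - (i%:R * de) *: u.
      by rewrite addrAC subrK.
    by rewrite scaleNr addrAC invrN mulrN -mulNr opprB.
  - move=> i im; apply: (ref_near _ (i.+1%:R * de)).
      rewrite addrAC [x - _ - x]addrAC subrr sub0r -opprD normrN -scalerDl normrZ.
      by rewrite -natr1 mulrDl mul1r addrC ger0_norm// addr_ge0 ?mulr_ge0// ltW.
    by rewrite mulr_ge0 ?(ltW de0)//= (le_trans _ msr)// ler_wpM2r ?ler_nat ?ltW.
  - rewrite leNgt; apply/negP => lt; apply: nP2; exists m; first by rewrite m0.
    apply: lt_le_trans lt _; apply: ler_sum => i _.
    by rewrite /g' /g wE scalerN scalerA addrAC.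
  - by rewrite mulrN normrN ger0_norm.
  - by move: ms sm; rewrite (ltr0_norm s0) normrN (gtr0_norm de0) -natr1 ler_norml; lra.
  - by rewrite normrN (gtr0_norm de0).
have := near _ tr; have := near _ t'r; move: osc; rewrite /e.
move: (dq f u t x) (dq f u t' x) (ref x) => a b c; rewrite !ltNge => /negP osc h1 h2.
apply: osc; have -> : a - b = (a - c) - (b - c) by ring.
apply: le_trans (ler_normB _ _) _; lra.
Qed.

End main_estimate.

(** * Covers by dyadic cubes *)

Lemma ler_sum_seq_sub (R : numDomainType) (T : eqType) (s r : seq T) (F : T -> R) :
  (forall t, 0 <= F t) -> uniq s -> {subset s <= r} ->
  \sum_(t <- s) F t <= \sum_(t <- r) F t.
Proof.
move=> F0; elim: s r => [|x s ih] r /= => [_ _|/andP[xs us] sr].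
  by rewrite big_nil sumr_ge0.
have xr : x \in r by rewrite sr ?mem_head.
rewrite big_cons (big_rem x xr)/= lerD2l ih// => y ys.
have := sr y; rewrite inE ys orbT => /(_ isT).
by rewrite (perm_mem (perm_to_rem xr)) inE => /predU1P[yx|//]; rewrite -yx ys in xs.
Qed.

Lemma row_norm_le (R : realFieldType) (n : nat) (x : 'rV[R]_n) (e : R) :
  0 <= e -> (forall i, `|x 0 i| <= e) -> `|x| <= e.
Proof.
move=> e0 xe; rewrite [leLHS]mx_normrE; apply: bigmax_le => // -[i j] _ /=.
by rewrite ord1.
Qed.

Lemma mx_norm_ge (R : realFieldType) (m n : nat) (x : 'M[R]_(m, n)) i j :
  `|x i j| <= `|x|.
Proof.
rewrite [leRHS]mx_normrE.
exact: (le_bigmax _ (fun ij : 'I_m * 'I_n => `|x ij.1 ij.2|) (i, j)).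
Qed.

Lemma row_norm_ge (R : realFieldType) (n : nat) (x : 'rV[R]_n) i :
  `|x 0 i| <= `|x|.
Proof. exact: mx_norm_ge. Qed.

Section content.
Context {R : realType} {n : nat}.
Implicit Types (x y : 'rV[R]_n).

(** Half-open cubes, so that those of one level partition the unit cube. *)
Definition cell l (c : grid l) : set 'rV[R]_n :=
  [set x | forall i, (c i)%:R * dyadic l <= x 0 i < (c i).+1%:R * dyadic l].

Lemma coarsen_proof l k (j : 'I_(2 ^ (l + k))) : (j %/ 2 ^ k < 2 ^ l)%N.
Proof. by rewrite ltn_divLR ?expn_gt0// -expnD. Qed.

Definition coarsen l k (c : @grid n (l + k)) : @grid n l :=
  [ffun i => Ordinal (coarsen_proof (c i))].

Definition unit_cube : set 'rV[R]_n := [set x | forall i, 0 <= x 0 i < 1].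

Lemma cell_grid_pt l (c : grid l) : cell c (grid_pt c).
Proof.
by move=> i; rewrite mxE lexx/= ltr_pM2r ?dyadic_gt0// ltr_nat.
Qed.

Lemma unit_cube_cell l x : unit_cube x -> exists c : grid l, cell c x.
Proof.
move=> x01.
have d0 := @dyadic_gt0 R l.
have xd i : 0 <= x 0 i / dyadic l.
  by have /andP[x0 _] := x01 i; rewrite divr_ge0// ltW.
have lt (i : 'I_n) : (Num.truncn (x 0 i / dyadic l)%R < 2 ^ l)%N.
  rewrite truncn_lt_nat// ltr_pdivrMr//; have /andP[_ x1] := x01 i.
  by rewrite /dyadic natrX mulfV// expf_neq0// pnatr_eq0.
exists [ffun i => Ordinal (lt i)] => i; rewrite ffunE/=.
by have := truncn_itv (xd i); rewrite ler_pdivlMr// ltr_pdivrMr.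
Qed.

Lemma cell_inj l (c d : grid l) x : cell c x -> cell d x -> c = d.
Proof.
move=> cx dx; apply/ffunP => i; apply/val_inj => /=.
have d0 := @dyadic_gt0 R l.
have /andP[c1 c2] := cx i; have /andP[d1 d2] := dx i.
have := le_lt_trans c1 d2; have := le_lt_trans d1 c2.
rewrite !ltr_pM2r// !ltr_nat; lia.
Qed.

Lemma cell_coarsen l k (c : grid (l + k)) x : cell c x -> cell (coarsen c) x.
Proof.
move=> cx i; have /andP[c1 c2] := cx i; rewrite ffunE/=.
have d0 := @dyadic_gt0 R (l + k).
rewrite (dyadicD l k) !mulrA -!natrM; apply/andP; split.
  by apply: le_trans c1; rewrite ler_pM2r// ler_nat leq_trunc_div.
by apply: lt_le_trans c2 _; rewrite ler_pM2r// ler_nat ltn_ceil// expn_gt0.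
Qed.

Lemma coarsen_refine l k (d : grid l) (r : grid k) : coarsen (refine d r) = d.
Proof.
apply/ffunP => i; apply/val_inj; rewrite !ffunE/= divnMDl ?expn_gt0//.
by rewrite divn_small// addn0.
Qed.

Lemma cell_dist l (c : grid l) x y : cell c x -> cell c y ->
  `|x - y| <= dyadic l.
Proof.
move=> cx cy; apply: row_norm_le; rewrite ?dyadic_ge0// => j; rewrite !mxE.
have := cx j; have := cy j; rewrite -!natr1 !mulrDl mul1r ler_norml; lra.
Qed.

End content.

Section content_cover.
Context {R : realType} {n : nat}.
Implicit Types (x y : 'rV[R]_n).

Definition saturate (l : nat) (B : set 'rV[R]_n) : set 'rV[R]_n :=
  [set x | exists c : grid l, cell c x /\ exists2 y, cell c y & B y].

(* Splitting the union of the [B l] according to the first level at which the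
   dyadic cell of a point meets [B l] gives disjoint pieces, so that the volumes
   of the cells add up to the mean of a single indicator. *)
Definition first_hit (B : nat -> set 'rV[R]_n) (l : nat) : set 'rV[R]_n :=
  [set x | saturate l (B l) x /\
    forall l', (l' < l)%N -> ~ saturate l' (B l') x].

(** A cell lies in a single cell of each coarser level, so saturation at a coarser level cannot
    separate its points. *)
Lemma saturate_cell l l' (c : grid l) (B : set 'rV[R]_n) x y : (l' <= l)%N ->
  cell c x -> cell c y -> saturate l' B x -> saturate l' B y.
Proof.
move=> l'l; rewrite -(subnKC l'l) in c *; move: (l - l')%N c => k c cx cy.
move=> [d [dx [w dw Bw]]].
rewrite (cell_inj dx (cell_coarsen cx)) in dw.
by exists (coarsen c); split; [exact: cell_coarsen|exists w].
Qed.

Lemma first_hit_cell B l (c : grid l) x y :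
  cell c x -> cell c y -> first_hit B l x -> first_hit B l y.
Proof.
move=> cx cy [hx nx]; split; first exact: (saturate_cell (leqnn l) cx cy).
move=> l' l'l hy; apply: (nx l' l'l).
exact: (saturate_cell (ltnW l'l) cy cx).
Qed.

(** [first_hit B l] is a union of cells of level [l], each containing the same number of points of
    the finer grid. *)
Lemma mean_first_hit B l L : (l <= L)%N ->
  mean L \1_(first_hit B l) = mean l \1_(first_hit B l).
Proof.
move=> lL; rewrite -(subnKC lL); apply: mean_refine => d r; rewrite !indicE.
congr (nat_of_bool _)%:R; apply/idP/idP => /set_mem h; apply/mem_set; move: h.
  apply: (@first_hit_cell _ _ d); last exact: cell_grid_pt.
  by rewrite -{1}(coarsen_refine d r); apply/cell_coarsen/cell_grid_pt.
apply: (@first_hit_cell _ _ d); first exact: cell_grid_pt.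
by rewrite -{1}(coarsen_refine d r); apply/cell_coarsen/cell_grid_pt.
Qed.

Definition cell_box_ub l (c : @grid n l) : 'rV[R]_n :=
  grid_pt c + const_mx (dyadic l).

Lemma cell_box_volume l (c : @grid n l) :
  box_volume (grid_pt c) (cell_box_ub c) = #|{: @grid n l}|%:R^-1.
Proof.
rewrite /box_volume (eq_bigr (fun=> dyadic l)); last first.
  by move=> i _; rewrite !mxE addrAC subrr add0r.
by rewrite prodr_const card_ord card_grid /dyadic !natrX exprVn.
Qed.

(** A cell meeting [B l] lies in [B' l], its diameter being at most [dyadic l]. Finitely many
    selected cells, of levels up to [Q], thus lie disjointly in [B' Q], and one fine grid bounds
    their total volume. *)
Lemma unit_cube_cover (B B' : nat -> set 'rV[R]_n) (eta : R) :
  (forall l x y, B l x -> `|x - y| <= dyadic l -> B' l y) ->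
  (forall l l', (l <= l')%N -> B' l `<=` B' l') ->
  (forall l L0, exists2 L, (L0 <= L)%N & mean L \1_(B' l) <= eta) ->
  exists (T : countType) (S : set T) (a b : T -> 'rV[R]_n),
    [/\ forall t i, a t 0 i <= b t 0 i,
        unit_cube `&` \bigcup_l B l `<=` \bigcup_(t in S) box (a t) (b t)
      & forall s : seq T, uniq s -> (forall t, t \in s -> S t) ->
          \sum_(t <- s) box_volume (a t) (b t) <= eta].
Proof.
move=> BB' B'mono B'mean.
exists {l : nat & @grid n l}.
exists [set t | first_hit B (tag t) (grid_pt (tagged t))].
exists (fun t => grid_pt (tagged t)), (fun t => cell_box_ub (tagged t)); split.
- by move=> t i; rewrite !mxE lerDl dyadic_ge0.
- move=> x [x01 [l0 _ Bx]].
  have ex : exists l, `[< saturate l (B l) x >].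
    exists l0; apply/asboolP; have [c cx] := unit_cube_cell l0 x01.
    by exists c; split=> //; exists x.
  have [l /asboolP hx lmin] := ex_minnP ex.
  have fx : first_hit B l x.
    split=> // l' l'l hx'; have := lmin l' (introT (asboolP _) hx').
    by rewrite leqNgt l'l.
  have [c cx] := unit_cube_cell l x01.
  exists (Tagged (fun l => @grid n l) c) => /=.
    exact: (first_hit_cell cx (cell_grid_pt c) fx).
  move=> i; have /andP[h1 h2] := cx i; rewrite !mxE h1/=.
  by move: h2; rewrite -natr1 mulrDl mul1r => /ltW.
- move=> s us sS.
  pose vol (t : {l : nat & @grid n l}) : R := #|{: @grid n (tag t)}|%:R^-1.
  pose F (t : {l : nat & @grid n l}) : R :=
    \1_(first_hit B (tag t)) (grid_pt (tagged t)) * vol t.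
  have F0 t : 0 <= F t by rewrite mulr_ge0// ?invr_ge0// indicE.
  have -> : \sum_(t <- s) box_volume (grid_pt (tagged t)) (cell_box_ub (tagged t))
      = \sum_(t <- s) F t.
    apply: eq_big_seq => t /sS St; rewrite cell_box_volume /F indicE mem_set//.
    by rewrite mul1r.
  pose Q := (\max_(t <- s) tag t)%N.
  have [I Iu memI] : exists2 I : seq nat, uniq I
      & forall l, (l \in I) = (l <= Q)%N.
    by exists (iota 0 Q.+1) => [|l]; rewrite ?iota_uniq// mem_iota.
  pose r := [seq Tagged (fun l => @grid n l) c | l <- I,
               c <- enum {: @grid n l}].
  apply: (@le_trans _ _ (\sum_(t <- r) F t)).
    apply: ler_sum_seq_sub => // t ts; apply/allpairsPdep.
    exists (tag t), (tagged t); split; rewrite ?mem_enum//; last by case: (t).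
    by rewrite memI (leq_bigmax_seq (F := fun t => tag t)).
  rewrite big_allpairs_dep/=.
  (* A cell of level [l] has volume one over the number of grid points, so the sum over one level is
     a mean. *)
  rewrite (eq_bigr (fun l => mean l \1_(first_hit B l))); last first.
    move=> l _; rewrite /mean mulrC mulr_suml big_enum/=.
    by apply: eq_bigr => c _.
  have [L QL LB] := B'mean Q Q.
  rewrite (eq_big_seq (fun l => mean L \1_(first_hit B l))); last first.
    by move=> l; rewrite memI => lQ; rewrite mean_first_hit//; lia.
  apply: le_trans LB; rewrite -mean_sum; apply: mean_le => x.
  have [|nB'] := boolP (x \in B' Q); last first.
    rewrite big_seq big1 ?indicE ?(negbTE nB')// => l; rewrite memI => lQ.
    rewrite indicE memNset// => -[[c [cx [y cy By]]] _].
    move/negP: nB'; apply; apply/mem_set; apply: (B'mono l) => //.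
    by apply: (BB' _ _ _ By); exact: (cell_dist cy cx).
  rewrite indicE => ->.
  (* A point has at most one first level, so at most one indicator is nonzero. *)
  have [[l lQ fl]|none] := pselect (exists2 l, (l <= Q)%N & first_hit B l x).
    rewrite (bigD1_seq l)/= ?Iu ?memI// big1_seq ?addr0.
      by rewrite indicE; case: (_ \in _).
    move=> l' /andP[l'l _]; rewrite indicE memNset// => -[h' n'].
    case: fl => h nh; case: (ltngtP l' l) => [lt|lt|E].
    - exact: nh lt h'.
    - exact: n' lt h.
    - by rewrite E eqxx in l'l.
  rewrite big1_seq// => l /andP[_]; rewrite memI => lQ.
  by rewrite indicE memNset// => fl; apply: none; exists l.
Qed.

End content_cover.

(** * Directional derivatives *)

Section directional_derivative.
Context {R : realType} {n : nat}.
Implicit Types (f g : 'rV[R]_n -> R) (u x y : 'rV[R]_n) (z : 'rV[int]_n).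

Definition dirder f u x (l : R) := forall e, 0 < e -> exists2 r, 0 < r &
  forall t, `|t| <= r -> `|f (x + t *: u) - f x - t * l| <= e * `|t|.

Lemma lip_norm C f : lip C f -> lip `|C| f.
Proof.
by move=> fC x y; apply: le_trans (fC x y) _; rewrite ler_wpM2r ?ler_norm.
Qed.

Lemma dirder_cauchy C f u x : lip C f ->
  (forall e, 0 < e -> exists2 r, 0 < r & forall t t',
     0 < `|t| <= r -> 0 < `|t'| <= r -> `|dq f u t x - dq f u t' x| <= e) ->
  exists l, dirder f u x l.
Proof.
move=> fC cau.
(* [sup A] is the lower limit of the quotients as [t] tends to 0. *)
pose A := [set q | exists2 r, 0 < r & forall t, 0 < `|t| <= r -> q <= dq f u t x].
have ubA (t r : R) e : 0 < r -> 0 < `|t| <= r ->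
    (forall t t', 0 < `|t| <= r -> 0 < `|t'| <= r ->
      `|dq f u t x - dq f u t' x| <= e) -> ubound A (dq f u t x + e).
  move=> r0 tr h q [r' r'0 qr']; pose s := Num.min r r'.
  have s0 : 0 < s by rewrite lt_min r0.
  have ss : 0 < `|s| <= r by rewrite gtr0_norm// s0 ge_min lexx.
  have := qr' s; rewrite gtr0_norm// s0 ge_min lexx orbT => /(_ isT).
  by have := h _ _ tr ss; rewrite ler_norml; lra.
have hsA : has_sup A.
  have [r r0 h] := cau 1 ltr01.
  have rr : 0 < `|r| <= r by rewrite gtr0_norm// r0 lexx.
  split; last by exists (dq f u r x + 1); exact: ubA r0 rr h.
  exists (dq f u r x - 1), r => // t tr.
  by have := h _ _ tr rr; rewrite ler_norml; lra.
exists (sup A) => e e0; have [r r0 h] := cau e e0.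
exists r => // t tr; have [->|t0] := eqVneq t 0.
  by rewrite scale0r addr0 subrr mul0r subrr normr0 mulr0.
have t0' : 0 < `|t| <= r by rewrite normr_gt0 t0.
have -> : f (x + t *: u) - f x - t * sup A = (dq f u t x - sup A) * t.
  by rewrite /dq; field.
rewrite normrM ler_wpM2r// ler_norml; apply/andP; split.
  suff : sup A <= dq f u t x + e by lra.
  by apply: sup_le_ub; [case: hsA|exact: ubA h].
suff : dq f u t x - e <= sup A by lra.
apply: (ub_le_sup (proj2 hsA)).
by exists r => // t' t'r; have := h _ _ t0' t'r; rewrite ler_norml; lra.
Qed.

Lemma dirder_unique f u x l l' : dirder f u x l -> dirder f u x l' -> l = l'.
Proof.
move=> fl fl'; apply/eqP; rewrite -subr_eq0 -normr_le0.
apply/ler_addgt0Pl => e e0; rewrite addr0.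
have e20 : 0 < e / 2 by rewrite divr_gt0.
have [r r0 h] := fl _ e20; have [r' r'0 h'] := fl' _ e20.
pose t := Num.min r r'; have t0 : 0 < t by rewrite lt_min r0.
have := h t; have := h' t; rewrite !(gtr0_norm t0) !ge_min !lexx orbT.
move=> /(_ isT) h2 /(_ isT) h1.
rewrite -(ler_pM2r t0) -{1}(gtr0_norm t0) -normrM.
have -> : (l - l') * t = (f (x + t *: u) - f x - t * l') - (f (x + t *: u) - f x - t * l).
  by ring.
by apply: le_trans (ler_normB _ _) _; lra.
Qed.

Lemma dirder_local f g u x l : (exists2 r, 0 < r &
    forall y, `|y - x| <= r -> f y = g y) ->
  dirder f u x l -> dirder g u x l.
Proof.
move=> [r r0 fg] fl e e0; have [r' r'0 h] := fl e e0.
have u1 : 0 < `|u| + 1 by rewrite ltr_wpDl.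
exists (Num.min r' (r / (`|u| + 1))); first by rewrite lt_min r'0 divr_gt0.
move=> t; rewrite le_min => /andP[tr' tr].
rewrite -!fg ?subrr ?normr0 ?(ltW r0)//; first exact: h.
rewrite addrC addKr normrZ; move: tr; rewrite ler_pdivlMr//; apply: le_trans.
by rewrite ler_wpM2l// lerDl.
Qed.

(** At scales above [rho], a displacement by [dyadic l] changes a quotient by at most
    [2 |C| dyadic l / rho]; the factor 8 makes this at most [eps / 4], spent once for each of the
    two quotients. *)
Lemma oscillates_near C f u (eps r : R) l x y : lip C f -> 0 < eps ->
  let rho := 8 * (`|C| + 1) / eps * dyadic l in
  oscillates f u eps r rho x -> `|x - y| <= dyadic l ->
  oscillates f u (eps / 2) r rho y.
Proof.
move=> /lip_norm fC eps0 rho [t [t' [tr t'r osc]]] xy; exists t, t'; split=> //.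
have C1 : 0 < `|C| + 1 by rewrite ltr_wpDl.
have dl := @dyadic_gt0 R l.
have rho0 : 0 < rho by rewrite mulr_gt0// divr_gt0 ?mulr_gt0.
have near s : rho <= `|s| <= r -> `|dq f u s x - dq f u s y| <= eps / 4.
  move=> /andP[rs _]; apply: le_trans (dq_lip _ _ _ _ fC) _.
  have s0 := lt_le_trans rho0 rs.
  rewrite ler_pdivrMr//; apply: (@le_trans _ _ (eps / 4 * rho)).
    have -> : eps / 4 * rho = 2 * (`|C| + 1) * dyadic l.
      by rewrite /rho; field; rewrite gt_eqF.
    by apply: ler_pM => //; rewrite ?mulr_ge0// ler_pM2l// lerDl.
  by rewrite ler_pM2l ?divr_gt0.
have := near _ tr; have := near _ t'r; move: osc.
move: (dq f u t x) (dq f u t' x) (dq f u t y) (dq f u t' y) => a b a' b'.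
move=> osc h1 h2; rewrite ltNge; apply/negP => h3; move: osc; apply/negP.
rewrite -leNgt; have -> : a - b = (a - a') - (b - b') + (a' - b') by ring.
apply: le_trans (ler_normD _ _) _; apply: le_trans (lerD (ler_normB _ _) h3) _.
lra.
Qed.

(** Where the Cauchy criterion fails, the quotients oscillate by more than some [1 / (j + 1)] at
    arbitrarily small scales; for each [j] these points have covers of arbitrarily small volume. *)
Lemma null_not_dirder_periodic C f z : zperiodic f -> lip C f ->
  lebesgue_null
    (unit_cube `&` [set x | ~ exists l, dirder f (int_vec z) x l]).
Proof.
move=> fper fC; set u := int_vec z.
have C1 : 0 < `|C| + 1 by rewrite ltr_wpDl.
pose N j := unit_cube `&` [set x | forall r, 0 < r -> exists2 rho, 0 < rho
   & oscillates f u j.+1%:R^-1 r rho x].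
apply: (@lebesgue_null_sub _ _ _ (\bigcup_j N j)) => [x [x01 nd]|].
  apply: contrapT => noN; apply: nd; apply: (dirder_cauchy fC) => e e0.
  apply: contrapT => no; apply: noN.
  exists (Num.truncn e^-1) => //; split=> // r r0; apply: contrapT => noosc.
  apply: no; exists r => // t t' /andP[t0 tr] /andP[t'0 t'r].
  rewrite leNgt; apply/negP => et; apply: noosc.
  exists (Num.min `|t| `|t'|); first by rewrite lt_min t0.
  exists t, t'; rewrite !ge_min !lexx !orbT tr t'r; split=> //.
  apply: lt_trans et; rewrite -[ltRHS]invrK ltf_pV2 ?posrE ?invr_gt0//.
  exact: truncnS_gt.
apply: lebesgue_null_bigcup => j; apply: lebesgue_null_countable_cover.
move=> eta eta0; set eps : R := j.+1%:R^-1.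
have eps0 : 0 < eps by rewrite invr_gt0.
have eps20 : 0 < eps / 2 by rewrite divr_gt0.
(* This [r] does not depend on the cutoff, so it serves all cutoffs [c * dyadic l] at once. *)
have [r r0 osc] := mean_oscillates z fper fC eps20 eta0.
pose c := 8 * (`|C| + 1) / eps.
have c0 : 0 < c by rewrite divr_gt0// mulr_gt0.
have [|||T [S [a [b [ab sub sum]]]]] := @unit_cube_cover R n
  (fun l => oscillates f u eps r (c * dyadic l))
  (fun l => oscillates f u (eps / 2) r (c * dyadic l)) eta.
- move=> l x y; exact: (oscillates_near fC).
- move=> l l' ll' x [t [t' [/andP[tr1 tr2] /andP[t'r1 t'r2] h]]].
  have dll' : c * dyadic l' <= c * dyadic l.
    by rewrite ler_pM2l// -(subnK ll') dyadic_leD.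
  by exists t, t'; rewrite tr2 t'r2 (le_trans dll' tr1) (le_trans dll' t'r1).
- by move=> l L0; apply: osc; rewrite mulr_gt0 ?dyadic_gt0.
exists T, S, a, b; split=> //; apply: subset_trans sub => x [x01 hx]; split=> //.
have [rho rho0 [t [t' [/andP[tr1 tr2] /andP[t'r1 t'r2] h]]]] := hx r r0.
have [l dl] := @dyadic_small R (rho / c) (divr_gt0 rho0 c0).
exists l => //; have {}dl : c * dyadic l <= rho by rewrite mulrC -ler_pdivlMr.
by exists t, t'; rewrite tr2 t'r2 (le_trans dl tr1) (le_trans dl t'r1).
Qed.

End directional_derivative.

(** * Reduction to periodic functions by folding *)

Section folding.
Context {R : realType}.
Implicit Types (t s : R).

(* Precomposition with [fold_unit] in each coordinate makes any function
   periodic, and changes nothing on the cube [0, 1/2]^n. *)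
Definition fold_unit t : R :=
  Num.min (t - (Num.floor t)%:~R) (1 - (t - (Num.floor t)%:~R)).

Lemma fold_unit_le t (k : int) : fold_unit t <= `|t - k%:~R|.
Proof.
have /andP[h1 h2] := floor_itv t; rewrite /fold_unit ge_min.
have [kt|tk] := leP k (Num.floor t).
  rewrite -(ler_int R) in kt; apply/orP; left.
  by rewrite ger0_norm; lra.
rewrite -lezD1 -(ler_int R) in tk; apply/orP; right.
rewrite intrD in tk h2; rewrite ler0_norm; lra.
Qed.

Lemma fold_unit_eq t : exists k : int, fold_unit t = `|t - k%:~R|.
Proof.
have /andP[h1 h2] := floor_itv t; rewrite /fold_unit /Num.min; case: ifP => _.
  by exists (Num.floor t); rewrite ger0_norm; lra.
exists (Num.floor t + 1); rewrite intrD in h2 *; rewrite ler0_norm; lra.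
Qed.

(** By the two preceding lemmas [fold_unit] is the distance to the integers. *)
Lemma fold_unit_lip t s : `|fold_unit t - fold_unit s| <= `|t - s|.
Proof.
have half a b : fold_unit a - fold_unit b <= `|a - b|.
  have [k ->] := fold_unit_eq b; have := fold_unit_le a k.
  by have := ler_distD b a k%:~R; lra.
by rewrite ler_norml half andbT lerNl opprB distrC half.
Qed.

Lemma fold_unitD t (k : int) : fold_unit (t + k%:~R) = fold_unit t.
Proof. by rewrite /fold_unit floorDrz ?intr_int// intrKfloor intrD opprD addrACA subrr addr0. Qed.

Lemma fold_unit_id t : 0 <= t <= 2^-1 -> fold_unit t = t.
Proof.
move=> /andP[t0 t1]; have E : Num.floor t = 0.
  by apply/floor_def; rewrite t0/=; lra.
by rewrite /fold_unit E subr0; apply/min_l; lra.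
Qed.

End folding.

Section dirder_ae.
Context {R : realType} {n : nat}.
Implicit Types (f g : 'rV[R]_n -> R) (u x y : 'rV[R]_n) (z : 'rV[int]_n).

Definition fold_vec x : 'rV[R]_n := \row_i fold_unit (x 0 i).

Lemma fold_vec_lip x y : `|fold_vec x - fold_vec y| <= `|x - y|.
Proof.
apply: row_norm_le => // i; rewrite !mxE (le_trans (fold_unit_lip _ _))//.
by have := row_norm_ge (x - y) i; rewrite !mxE.
Qed.

Lemma null_not_dirder C f z : lip C f ->
  lebesgue_null [set x | ~ exists l, dirder f (int_vec z) x l].
Proof.
move=> /lip_norm fC.
pose x0 (k : 'rV[int]_n) : 'rV[R]_n := 8^-1 *: int_vec k.
pose F k x := f (x0 k + fold_vec x).
have Fper k : zperiodic (F k).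
  move=> y x; rewrite /F; congr (f (_ + _)); apply/rowP => i.
  by rewrite !mxE fold_unitD.
have FC k : lip `|C| (F k).
  move=> x y; apply: le_trans (fC _ _) _.
  rewrite opprD addrACA subrr add0r ler_wpM2l//; exact: fold_vec_lip.
apply: (@lebesgue_null_sub _ _ _ (\bigcup_(k : 'rV[int]_n) [set x |
   (unit_cube `&` [set x | ~ exists l, dirder (F k) (int_vec z) x l]) (x - x0 k)])).
  (* This [k] puts [x - x0 k] into [[1/8, 1/4)^n], so the ball of radius [1/8] around it stays in
     [[0, 1/2]^n], where folding is the identity. *)
  move=> x nd; pose k : 'rV[int]_n := \row_i (Num.floor (8 * x 0 i) - 1).
  exists k => //; pose y := x - x0 k.
  have yi i : 8^-1 <= y 0 i < 4^-1.
    rewrite !mxE intrB; have /andP[] := floor_itv (8 * x 0 i); rewrite intrD; lra.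
  split=> [i|[l Fl]]; first by have := yi i; rewrite -/y; lra.
  apply: nd; exists l.
  have Fl' : dirder (fun w => F k (w - x0 k)) (int_vec z) x l.
    move=> e /Fl[r r0 h]; exists r => // t /h.
    by rewrite [x - x0 k + _]addrAC.
  apply: dirder_local Fl'; exists 8^-1 => [|w wx]; first by rewrite invr_gt0.
  rewrite /F; congr f; apply/rowP => i; rewrite [LHS]mxE [fold_vec _ _ _]mxE.
  rewrite fold_unit_id.
    by rewrite !mxE addrC subrK.
  have := yi i; have := le_trans (row_norm_ge (w - x) i) wx.
  by rewrite !mxE ler_norml; lra.
apply: lebesgue_null_bigcup => k; apply: lebesgue_null_translate.
exact: null_not_dirder_periodic (Fper k) (FC k).
Qed.

End dirder_ae.

(** * McShane's extension of Lipschitz functions *)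

Section mcshane.
Context {R : realType} {n : nat}.
Variables (A : set 'rV[R]_n) (g : 'rV[R]_n -> R) (C : R).
Hypotheses (C0 : 0 <= C)
  (gC : forall x y, A x -> A y -> `|g x - g y| <= C * `|x - y|).
Implicit Types x y : 'rV[R]_n.

Definition mcshane x : R := inf [set g a + C * `|x - a| | a in A].

Let has_inf_mcshane a x : A a -> has_inf [set g a + C * `|x - a| | a in A].
Proof.
move=> Aa; split; first by exists (g a + C * `|x - a|), a.
exists (g a - C * `|x - a|) => _ [b Ab <-].
have := gC Aa Ab; have := ler_wpM2l C0 (ler_distD x a b).
rewrite [`|a - x|]distrC mulrDr ler_norml; lra.
Qed.

Lemma mcshane_id a : A a -> mcshane a = g a.
Proof.
move=> Aa; apply/eqP; rewrite eq_le; apply/andP; split.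
  apply: ge_inf; first by case: (has_inf_mcshane a Aa).
  by exists a => //; rewrite subrr normr0 mulr0 addr0.
apply: lb_le_inf; first by exists (g a + C * `|a - a|), a.
by move=> _ [b Ab <-]; have := gC Aa Ab; rewrite ler_norml; lra.
Qed.

Lemma mcshane_lip : lip C mcshane.
Proof.
move=> x y; have [[a Aa]|none] := pselect (exists a, A a); last first.
  have E w : mcshane w = 0.
    (* For empty [A] the infimum takes its default value 0, and the extension is constant. *)
    by rewrite /mcshane -[RHS](@inf0 R); congr inf; rewrite -subset0 => q [b Ab]; case: none; exists b.
  by rewrite !E subrr normr0 mulr_ge0.
have half v w : mcshane v - C * `|v - w| <= mcshane w.
  apply: lb_le_inf; first by exists (g a + C * `|w - a|), a.
  move=> _ [b Ab <-].
  have : mcshane v <= g b + C * `|v - b|.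
    by apply: ge_inf; [case: (has_inf_mcshane v Aa)|exists b].
  by have := ler_wpM2l C0 (ler_distD w v b); rewrite mulrDr; lra.
have := half x y; have := half y x; rewrite [`|y - x|]distrC ler_norml; lra.
Qed.

Lemma mcshane_adherent x e : A !=set0 -> 0 < e ->
  exists2 a, A a & g a + C * `|x - a| < mcshane x + e.
Proof.
move=> [a0 Aa0] e0; have [q [a Aa <-] h] := inf_adherent e0 (has_inf_mcshane x Aa0).
by exists a.
Qed.

End mcshane.

(** * Additivity of the directional derivative *)

Section additivity.
Context {R : realType} {n : nat}.
Implicit Types (f : 'rV[R]_n -> R) (u x y : 'rV[R]_n) (z : 'rV[int]_n) (A : set 'rV[R]_n).

(** Extending 0 from [A] with constant 1 gives the distance to [A]. *)
Definition set_dist A := mcshane A (fun=> 0 : R) 1.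

Lemma set_dist_lip A : lip 1 (set_dist A).
Proof.
apply: mcshane_lip => // x y _ _.
by rewrite subrr normr0 mul1r.
Qed.

(* The distance to A is nonnegative and vanishes at x, so its directional
   derivative at x, being two-sided, is zero. *)
Lemma set_dist_dirder A u x l : A x -> dirder (set_dist A) u x l ->
  forall e, 0 < e -> exists2 r, 0 < r & forall t, 0 < t <= r ->
    exists2 y, A y & `|x + t *: u - y| <= e * t.
Proof.
move=> Ax dl e e0; have A0 : A !=set0 by exists x.
have h0 y w : A y -> A w -> `|(0 : R) - 0| <= 1 * `|y - w|.
  by rewrite subrr normr0 mul1r.
have dx : set_dist A x = 0 := mcshane_id (g := fun=> 0) ler01 h0 Ax.
have d0 y : 0 <= set_dist A y.
  apply: lb_le_inf; first by exists (0 + 1 * `|y - x|), x.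
  by move=> _ [a _ <-]; rewrite add0r mul1r.
have e40 : 0 < e / 4 by rewrite divr_gt0.
have [r r0 h] := dl _ e40; exists r => // t /andP[t0 tr].
(* Nonnegativity at [x - t u] gives [t l <= e / 4 * t], so the distance at [x + t u] is at most
   [e / 2 * t]; choosing a nearly closest point costs another [e / 4 * t]. *)
have := h (- t); have := h t; rewrite normrN gtr0_norm// tr dx !subr0.
move=> /(_ isT) h1 /(_ isT) h2.
have := d0 (x + - t *: u); have := d0 (x + t *: u).
have et0 : 0 < e / 4 * t by rewrite mulr_gt0.
have [y Ay] := @mcshane_adherent _ _ A (fun=> 0) 1 ler01 h0 (x + t *: u) _ A0 et0.
rewrite add0r mul1r -/(set_dist A) => hy d1 d2; exists y => //; apply: le_trans (ltW hy) _.
by move: h1 h2; rewrite !ler_norml; lra.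
Qed.

(* On the set A of points at which f has slope nearly q = k / (j + 1) in direction
   v at all scales below 1 / (i + 1), some point of A lies within o(t) of x + t u
   (set_dist_dirder), and moving from it by t v changes f by nearly t q. *)
Lemma null_not_dirderD C f z1 z2 : lip C f ->
  lebesgue_null [set x | ~ exists l1 l2, [/\ dirder f (int_vec z1) x l1,
     dirder f (int_vec z2) x l2 & dirder f (int_vec (z1 + z2)) x (l1 + l2)]].
Proof.
move=> fC; set u : 'rV[R]_n := int_vec z1; set v : 'rV[R]_n := int_vec z2.
have fC' := lip_norm fC; have C0 : 0 <= `|C| := normr_ge0 C.
pose nd (h : 'rV[R]_n -> R) z := [set x | ~ exists l, dirder h (int_vec z) x l].
pose A (p : nat * int * nat) := [set x : 'rV[R]_n | forall t,
  0 < t <= p.2.+1%:R^-1 ->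
  `|f (x + t *: v) - f x - t * (p.1.2%:~R / p.1.1.+1%:R)| <= 2 / p.1.1.+1%:R * t].
apply: (@lebesgue_null_sub _ _ _ ((nd f z1 `|` nd f z2) `|` nd f (z1 + z2)
   `|` \bigcup_p nd (set_dist (A p)) z1)); last first.
  apply: lebesgue_null_setU.
    do 2?apply: lebesgue_null_setU; exact: null_not_dirder fC.
  by apply: lebesgue_null_bigcup => p; exact: null_not_dirder (set_dist_lip _).
move=> x bad; apply: contrapT => /not_orP[/not_orP[/not_orP[]]].
move=> /contrapT[l1 f1] /contrapT[l2 f2] /contrapT[l3 f3] distA; apply: bad.
exists l1, l2; split=> //; suff -> : l1 + l2 = l3 by [].
apply/esym/eqP; rewrite -subr_eq0 -normr_le0; apply/ler_addgt0Pl => e e0.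
(* Replacing [x + t u] by [y] costs [|C| d t] twice; the slopes along [u], [u + v] and [v] and the
   rounding of [l2] cost at most [6 d t] together. *)
rewrite addr0; pose K := 2 * `|C| + 6.
have K0 : 0 < K by rewrite ltr_wpDl// mulr_ge0.
pose j := Num.truncn (K / e); pose d : R := j.+1%:R^-1.
have d0 : 0 < d by rewrite invr_gt0.
have de : K * d <= e.
  rewrite ler_pdivrMr// mulrC -ler_pdivrMr//; exact/ltW/truncnS_gt.
pose k := Num.floor (l2 / d).
have kl2 : `|l2 - k%:~R * d| <= d.
  have /andP[] := floor_itv (l2 / d); rewrite -/k intrD ler_pdivlMr// ltr_pdivrMr//.
  by rewrite mulrDl mul1r ler_norml; lra.
have [r1 r10 h1] := f1 _ d0; have [r2 r20 h2] := f2 _ d0.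
have [r3 r30 h3] := f3 _ d0.
pose i := Num.truncn r2^-1.
have ir2 : i.+1%:R^-1 <= r2.
  by rewrite -[leRHS]invrK lef_pV2 ?posrE ?invr_gt0// ltW// truncnS_gt.
have Ax : A (j, k, i) x.
  move=> t /andP[t0 ti]; have := h2 t; rewrite gtr0_norm// (le_trans ti)//.
  move=> /(_ isT); rewrite /= -/d => h.
  have -> : f (x + t *: v) - f x - t * (k%:~R * d)
     = (f (x + t *: v) - f x - t * l2) + t * (l2 - k%:~R * d) by ring.
  apply: le_trans (ler_normD _ _) _; rewrite normrM (gtr0_norm t0).
  by have := ler_wpM2l (ltW t0) kl2; lra.
have [l dl] : exists l, dirder (set_dist (A (j, k, i))) u x l.
  by apply: contrapT => no; apply: distA; exists (j, k, i).
have [r r0 near] := set_dist_dirder Ax dl d0.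
pose t := Num.min (Num.min r r1) (Num.min r3 i.+1%:R^-1).
have t0 : 0 < t by rewrite !lt_min r0 r10 r30 invr_gt0 ltr0n.
have : t <= t by [].
rewrite {2}/t !le_min => /andP[/andP[tr tr1] /andP[tr3 ti]].
have [|y Ay xy] := near t; first by rewrite t0.
have {}h1 := h1 t; have {}h3 := h3 t; rewrite gtr0_norm// in h1 h3.
have {h1}h1 := h1 tr1; have {h3}h3 := h3 tr3.
have ay : `|f (y + t *: v) - f y - t * (k%:~R * d)| <= 2 * d * t.
  by apply: Ay; rewrite t0 ti.
have b1 : `|f (x + t *: u) - f y| <= `|C| * (d * t).
  by apply: le_trans (fC' _ _) _; rewrite ler_wpM2l.
have b2 : `|f (x + t *: (u + v)) - f (y + t *: v)| <= `|C| * (d * t).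
  apply: le_trans (fC' _ _) _; rewrite ler_wpM2l// scalerDr addrA.
  by rewrite opprD [_ + t *: v + _]addrACA subrr addr0.
have b3 : `|t * (k%:~R * d - l2)| <= t * d.
  by rewrite normrM gtr0_norm// ler_wpM2l ?(ltW t0)// distrC.
rewrite int_vecD -/u -/v in h3.
rewrite -(ler_pM2r t0) -{1}(gtr0_norm t0) -normrM.
have dt : K * d * t <= e * t by rewrite ler_pM2r.
apply: le_trans dt.
have := h1; have := h3; have := ay; have := b1; have := b2; have := b3.
have -> : K * d * t = 2 * (`|C| * (d * t)) + 6 * (d * t) by rewrite /K; ring.
have -> : 2 * d * t = 2 * (d * t) by ring.
have -> : t * d = d * t by ring.
have -> : (l3 - (l1 + l2)) * t = t * l3 - t * l1 - t * l2 by ring.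
have -> : t * (k%:~R * d - l2) = t * (k%:~R * d) - t * l2 by ring.
rewrite !ler_norml.
move: (`|C| * (d * t)) (d * t) (t * l3) (t * l1) (t * l2) (t * (k%:~R * d)).
move: (f (x + t *: (u + v))) (f (y + t *: v)) (f (x + t *: u)) (f y) (f x).
move=> F1 F2 F3 F4 F5 a1 a2 a3 a4 a5 a6; lra.
Qed.

End additivity.

(** * Rademacher's theorem on R^n *)

Section gradient.
Context {R : realType} {n : nat}.
Implicit Types (f : 'rV[R]_n -> R) (u x y a : 'rV[R]_n) (z : 'rV[int]_n).

Definition has_gradient f x a := forall e, 0 < e -> exists2 r, 0 < r &
  forall w : 'rV[R]_n, `|w| <= r ->
    `|f (x + w) - f x - \sum_i w 0 i * a 0 i| <= e * `|w|.

Lemma dirder0 f x : dirder f 0 x 0.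
Proof.
move=> e e0; exists 1 => // t _; rewrite scaler0 addr0 subrr mulr0 subr0 normr0.
by rewrite mulr_ge0// ltW.
Qed.

Lemma dirderZ f u x l (c : R) : dirder f u x l -> dirder f (c *: u) x (c * l).
Proof.
move=> fl e e0; have c1 : 0 < `|c| + 1 by rewrite ltr_wpDl.
have [r r0 h] := fl (e / (`|c| + 1)) (divr_gt0 e0 c1).
exists (r / (`|c| + 1)); first by rewrite divr_gt0.
move=> t; rewrite ler_pdivlMr// => tr.
have tc : `|t * c| <= `|t| * (`|c| + 1) by rewrite normrM ler_wpM2l// lerDl.
have := h (t * c) (le_trans tc tr); rewrite -scalerA -mulrA => /le_trans; apply.
rewrite -mulrA ler_wpM2l ?(ltW e0)// mulrC ler_pdivrMr//.
Qed.

(** An integer vector is the sum of its coordinate parts; uniqueness of derivatives identifies the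
    values supplied by additivity with those already computed. *)
Lemma dirder_linear f x (a : 'rV[R]_n) :
  (forall z1 z2, exists l1 l2, [/\ dirder f (int_vec z1) x l1,
     dirder f (int_vec z2) x l2 & dirder f (int_vec (z1 + z2)) x (l1 + l2)]) ->
  (forall i, dirder f (int_vec (delta_mx 0 i)) x (a 0 i)) ->
  forall z, dirder f (int_vec z) x (\sum_i (z 0 i)%:~R * a 0 i).
Proof.
move=> add fa z; rewrite {1}(row_sum_delta z).
apply: (big_ind2 (fun z l => dirder f (int_vec z) x l)).
- rewrite (_ : int_vec 0 = 0); first exact: dirder0.
  by apply/rowP => i; rewrite !mxE.
- move=> z1 l1 z2 l2 h1 h2; have [k1 [k2 [h1' h2' h]]] := add z1 z2.
  by rewrite (dirder_unique h1 h1') (dirder_unique h2 h2').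
- move=> i _; have -> : int_vec (z 0 i *: delta_mx 0 i)
      = (z 0 i)%:~R *: int_vec (delta_mx 0 i) :> 'rV[R]_n.
    by apply/rowP => k; rewrite !mxE intrM.
  exact: dirderZ (fa i).
Qed.

(* Approximates the direction of w by one of finitely many integer vectors. *)
Lemma dirder_gradient C f x a : lip C f ->
  (forall z, dirder f (int_vec z) x (\sum_i (z 0 i)%:~R * a 0 i)) ->
  has_gradient f x a.
Proof.
(* Three errors relative to [t = |w| / p]: moving [w] to [t z], the expansion along [z], and the
   change of the linear term. *)
move=> /lip_norm fC fa e e0; pose K := `|C| + 1 + \sum_i `|a 0 i|.
have K0 : 0 < K by rewrite ltr_wpDr ?sumr_ge0// ltr_wpDl.
pose p := (Num.truncn (K / e)).+1; have p0 : 0 < p%:R :> R by rewrite ltr0n.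
have Kp : K / p%:R <= e.
  by rewrite ler_pdivrMr// mulrC -ler_pdivrMr//; exact/ltW/truncnS_gt.
pose zc (c : {ffun 'I_n -> 'I_(p + p).+1}) : 'rV[int]_n := \row_i ((c i)%:Z - p%:Z).
have /choice[r rP] c : exists r, 0 < r /\ forall t, `|t| <= r ->
    `|f (x + t *: int_vec (zc c)) - f x - t * \sum_i (zc c 0 i)%:~R * a 0 i| <= `|t|.
  have [r r0 h] := fa (zc c) 1 ltr01; exists r; split=> // t /h.
  by rewrite mul1r.
exists (\big[Num.min/1]_c r c).
  by apply: lt_bigmin => // c _; case: (rP c).
move=> w wr; have [->|w0] := eqVneq w 0.
  rewrite addr0 subrr big1 ?subrr ?normr0 ?mulr0// => i _.
  by rewrite mxE mul0r.
(* [w / t] has sup norm [p], so rounding its coordinates down yields one of the finitely many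
   vectors [zc c]. *)
pose t := `|w| / p%:R; have t0 : 0 < t by rewrite divr_gt0 ?normr_gt0.
have wt : `|w| = t * p%:R by rewrite /t divfK ?gt_eqF.
pose z : 'rV[int]_n := \row_i Num.floor (w 0 i / t).
have zw i : `|w 0 i - t * (z 0 i)%:~R| <= t.
  have /andP[] := floor_itv (w 0 i / t); rewrite mxE intrD ler_pdivlMr// ltr_pdivrMr//.
  by rewrite mulrDl mul1r ler_norml; lra.
have zp i : - p%:Z <= z 0 i <= p%:Z.
  have := row_norm_ge w i; rewrite wt ler_norml => /andP[w1 w2]; rewrite mxE.
  apply/andP; split.
    by rewrite floor_ge_int mulrNz ler_pdivlMr// mulNr mulrC -pmulrn.
  rewrite -ltzD1 floor_lt_int ltr_pdivrMr// intrD -pmulrn mulrDl mul1r mulrC.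
  by rewrite (le_lt_trans w2)// ltrDl.
have [c zE] : exists c, z = zc c.
  exists [ffun i => inord (absz (z 0 i + p%:Z)%R)]; apply/rowP => i.
  rewrite [RHS]mxE ffunE inordK; last by have := zp i; lia.
  by have := zp i; lia.
have [_ /(_ t)] := rP c; rewrite gtr0_norm// -zE => h.
have {}h : `|f (x + t *: int_vec z) - f x - t * \sum_i (z 0 i)%:~R * a 0 i| <= t.
  apply: h; apply: le_trans (le_trans wr _); last exact: bigmin_le.
  by rewrite /t ler_pdivrMr// ler_peMr// ler1n.
have h1 : `|f (x + w) - f (x + t *: int_vec z)| <= `|C| * t.
  apply: le_trans (fC _ _) _; rewrite opprD addrACA subrr add0r ler_wpM2l//.
  by apply: row_norm_le (ltW t0) _ => i; have := zw i; rewrite !mxE.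
have h2 : `|\sum_i (t * (z 0 i)%:~R - w 0 i) * a 0 i| <= t * \sum_i `|a 0 i|.
  apply: le_trans (ler_norm_sum _ _ _) _; rewrite mulr_sumr.
  by apply: ler_sum => i _; rewrite normrM ler_wpM2r// distrC.
have -> : f (x + w) - f x - \sum_i w 0 i * a 0 i =
   (f (x + w) - f (x + t *: int_vec z))
   + (f (x + t *: int_vec z) - f x - t * \sum_i (z 0 i)%:~R * a 0 i)
   + \sum_i (t * (z 0 i)%:~R - w 0 i) * a 0 i.
  have -> : \sum_i (t * (z 0 i)%:~R - w 0 i) * a 0 i
      = t * \sum_i (z 0 i)%:~R * a 0 i - \sum_i w 0 i * a 0 i.
    by rewrite mulr_sumr -sumrB; apply: eq_bigr => i _; ring.
  by ring.
apply: (@le_trans _ _ (K / p%:R * `|w|)); last by rewrite ler_wpM2r.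
rewrite wt mulrACA mulVf ?gt_eqF// mulr1.
apply: le_trans (ler_normD _ _) _; apply: le_trans (lerD (ler_normD _ _) h2) _.
by rewrite /K !mulrDl mul1r [_ * t in leRHS]mulrC; lra.
Qed.

Lemma null_not_gradient C f : lip C f ->
  lebesgue_null [set x | ~ exists a, has_gradient f x a].
Proof.
move=> fC; apply: (@lebesgue_null_sub _ _ _ (\bigcup_(p : 'rV[int]_n * 'rV[int]_n)
   [set x | ~ exists l1 l2, [/\ dirder f (int_vec p.1) x l1,
     dirder f (int_vec p.2) x l2 & dirder f (int_vec (p.1 + p.2)) x (l1 + l2)]])).
  move=> x bad; apply: contrapT => good.
  have add z1 z2 : exists l1 l2, [/\ dirder f (int_vec z1) x l1,
     dirder f (int_vec z2) x l2 & dirder f (int_vec (z1 + z2)) x (l1 + l2)].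
    by apply: contrapT => no; apply: good; exists (z1, z2).
  have /choice[l lP] i : exists l, dirder f (int_vec (delta_mx 0 i)) x l.
    by have [l1 [l2 [h _ _]]] := add (delta_mx 0 i) 0; exists l1.
  apply: bad; exists (\row_i l i); apply: (dirder_gradient fC).
  by apply: dirder_linear => // i; rewrite mxE.
by apply: lebesgue_null_bigcup => p; exact: null_not_dirderD fC.
Qed.

End gradient.

Lemma near_norm (K : numFieldType) (V : normedModType K) (x : V) (r : K) :
  0 < r -> \forall y \near x, `|x - y| < r.
Proof. by move=> r0; apply/nbhs_normP; exists r. Qed.

Lemma near_norm_ex (K : numFieldType) (V : normedModType K) (x : V) (A : set V) :
  nbhs x A -> exists2 r, 0 < r & forall y, `|x - y| < r -> A y.
Proof. by move=> /nbhs_normP. Qed.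

Section rademacher.
Context {R : realType} {m n : nat}.
Implicit Types (F : 'rV[R]_m -> 'rV[R]_n) (S D V : set 'rV[R]_m).

Definition lip_in (C : R) S F := forall x y, S x -> S y ->
  `|F x - F y| <= C * `|x - y|.

Lemma lipschitz_lip_in S F : [lipschitz F y | y in S] ->
  exists2 C, 0 < C & lip_in C S F.
Proof.
move=> /pinfty_ex_gt0[C C0 h]; exists C => // x y Sx Sy.
by have := h (x, y) (conj Sx Sy).
Qed.

Lemma mulmxr_continuous (M : 'M[R]_(m, n)) :
  continuous (mulmxr M : 'rV[R]_m -> 'rV[R]_n).
Proof.
pose K := \sum_(j < n) \sum_(i < m) `|M i j|.
have K0 : 0 <= K by rewrite sumr_ge0// => j _; rewrite sumr_ge0.
move=> x; apply/(@cvgrPdist_le _ _ _ (nbhs x) (nbhs_filter x)) => e e0.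
have K1 : 0 < K + 1 by rewrite ltr_wpDl.
have : \forall y \near x, `|x - y| < e / (K + 1).
  by apply: near_norm; rewrite divr_gt0.
apply: filterS => y xy; rewrite -mulmxBl; apply: row_norm_le; first exact: ltW.
move=> j; rewrite mxE; apply: le_trans (ler_norm_sum _ _ _) _.
apply: (@le_trans _ _ (\sum_i `|x - y| * `|M i j|)).
  by apply: ler_sum => i _; rewrite normrM ler_wpM2r// row_norm_ge.
rewrite -mulr_sumr; apply: (@le_trans _ _ (`|x - y| * (K + 1))); last first.
  by rewrite -ler_pdivlMr// ltW.
rewrite ler_wpM2l// ler_wpDr// /K (bigD1 j)//= lerDl.
by rewrite sumr_ge0// => k _; rewrite sumr_ge0.
Qed.

(** The gradients are the columns of the derivative; near [x] the expansion is tested only at points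
    of [D] in [V], where each [h j] agrees with a coordinate of [F]. *)
Lemma gradient_differentiable_on D V F (h : 'I_n -> 'rV[R]_m -> R) x :
  D x -> nbhs x V -> (forall j y, (D `&` V) y -> h j y = F y 0 j) ->
  (forall j, exists a, has_gradient (h j) x a) ->
  differentiable_on D F x.
Proof.
move=> Dx Vx hF /choice[a aP]; apply/(differentiable_onP F Dx).
have nx : Filter (nbhs x) := nbhs_filter x.
exists (mulmxr (\matrix_(i, j) a j 0 i)); first exact: mulmxr_continuous.
move=> e e0.
have each j : \forall y \near x, D y ->
    `|(F y - (F x + (y - x) *m \matrix_(i, j) a j 0 i)) 0 j| <= e * `|y - x|.
  have [r r0 hr] := aP j e e0.
  have rx : nbhs x (fun y => `|y - x| < r).
    by apply: filterS (near_norm x r0) => y; rewrite distrC.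
  apply: filterS (filterI Vx rx) => y [Vy /ltW yr] Dy; have := hr _ yr.
  rewrite [x + _]addrC subrK !hF//; last by split=> //; exact: nbhs_singleton Vx.
  suff -> : (F y - (F x + (y - x) *m \matrix_(i, j) a j 0 i)) 0 j
      = F y 0 j - F x 0 j - \sum_i (y - x) 0 i * a j 0 i by [].
  rewrite !mxE opprD addrA; congr (_ - _).
  by apply: eq_bigr => i _; congr (_ * _); rewrite mxE.
have := @filter_forall _ 'I_n _ (nbhs x) nx each.
apply: filterS => y hy Dy; apply: row_norm_le; first by rewrite mulr_ge0// ltW.
by move=> j; exact: hy.
Qed.

(** Each coordinate is extended from [D] within [V] to a globally Lipschitz function, which has a
    gradient almost everywhere. *)
Lemma null_not_differentiable_on (C : R) D V F : 0 <= C ->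
  lip_in C (D `&` V) F ->
  lebesgue_null [set x | [/\ D x, nbhs x V & ~ differentiable_on D F x]].
Proof.
move=> C0 FC; set S := D `&` V.
have Fj j x y : S x -> S y -> `|F x 0 j - F y 0 j| <= C * `|x - y|.
  move=> Sx Sy; apply: le_trans (FC x y Sx Sy).
  by have := row_norm_ge (F x - F y) j; rewrite !mxE.
pose h j := mcshane S (fun y => F y 0 j) C.
have hC j : lip C (h j) := mcshane_lip C0 (Fj j).
apply: (@lebesgue_null_sub _ _ _ (\bigcup_(j : 'I_n)
   [set x | ~ exists a, has_gradient (h j) x a])); last first.
  by apply: lebesgue_null_bigcup => j; exact: null_not_gradient (hC j).
move=> x [Dx Vx nd]; apply: contrapT => no; apply: nd.
apply: (@gradient_differentiable_on D V F h) => //.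
  by move=> j y Sy; rewrite /h (mcshane_id C0 (Fj j)).
by move=> j; apply: contrapT => nj; apply: no; exists j.
Qed.

End rademacher.

(** * Manifolds *)

Section C1_lipschitz.
Context {R : realType} {m n : nat}.
Implicit Types (F : 'rV[R]_m -> 'rV[R]_n).

Lemma is_derive_line F (p v : 'rV[R]_m) (t : R) j :
  differentiable F (p + t *: v) ->
  is_derive t 1 (fun s => F (p + s *: v) 0 j)
    ((v *m jacobian F (p + t *: v)) 0 j).
Proof.
move=> dF; have dv := @diff_derivable _ _ _ _ _ v dF.
have E : (fun h : R => h^-1 *: (((fun s => F (p + s *: v) 0 j) \o shift t) (h *: 1)
     - F (p + t *: v) 0 j)) =
  (fun h : R => h^-1 *: (((fun y => F y 0 j) \o shift (p + t *: v)) (h *: v)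
     - F (p + t *: v) 0 j)).
  apply/funext => h; rewrite /= /shift /=; congr (_ *: (F _ 0 j - _)).
  by rewrite [h *: 1]mulr1 scalerDl addrCA.
apply: DeriveDef.
  by rewrite /derivable E; exact: (derivable_mxP _ _ _).1 dv 0 j.
rewrite /derive E -deriveEjacobian// derive_mx// mxE.
by [].
Qed.

(** The mean value theorem is applied to each coordinate along the segment; the factor [m] counts
    the terms of the product with the Jacobian in the sup norm. *)
Lemma mean_value_row F (K : R) (p q : 'rV[R]_m) : 0 <= K ->
  (forall t, 0 <= t <= 1 -> differentiable F (p + t *: (q - p))
     /\ `|jacobian F (p + t *: (q - p))| <= K) ->
  `|F q - F p| <= m%:R * K * `|q - p|.
Proof.
move=> K0 dF; apply: row_norm_le => [|j]; first by rewrite !mulr_ge0.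
set v := q - p.
have der (t : R) : 0 <= t <= 1 -> is_derive t 1 (fun s => F (p + s *: v) 0 j)
    ((v *m jacobian F (p + t *: v)) 0 j).
  by move=> /dF[? _]; exact: is_derive_line.
have [||c c01] := @MVT R (fun s => F (p + s *: v) 0 j)
  (fun t => (v *m jacobian F (p + t *: v)) 0 j) 0 1 ltr01.
- by move=> t; rewrite in_itv/= => /andP[/ltW t0 /ltW t1]; apply: der; rewrite t0.
- apply: derivable_within_continuous => t; rewrite in_itv/= => /der dt.
  exact: ex_derive.
rewrite scale1r scale0r addr0 subr0 mulr1 {1}/v [p + _]addrC subrK.
rewrite in_itv/= in c01; have /andP[/ltW c0 /ltW c1] := c01.
have [|_ Jc] := dF c; first by rewrite c0.
rewrite !mxE => ->; apply: le_trans (ler_norm_sum _ _ _) _.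
have -> : m%:R * K * `|v| = \sum_(i < m) K * `|v|.
  by rewrite sumr_const card_ord -mulrA mulr_natl.
apply: ler_sum => i _; rewrite normrM mulrC ler_pM ?row_norm_ge//.
exact: le_trans (mx_norm_ge _ _ _) Jc.
Qed.

(** Continuity bounds the Jacobian on a ball, which is convex and so contains the segments used by
    [mean_value_row]. *)
Lemma C1_on_lip (D : set 'rV[R]_m) F (x0 : 'rV[R]_m) : nbhs x0 D -> C1_on D F ->
  exists K r, [/\ 0 <= K, 0 < r, [set y | `|x0 - y| < r] `<=` D
    & lip_in K [set y | `|x0 - y| < r] F].
Proof.
move=> Dx0 FD; have [_ Jc] := FD _ (nbhs_singleton Dx0).
have nx : Filter (nbhs x0) := nbhs_filter x0.
have J1 : \forall y \near x0, `|jacobian F x0 - jacobian F y| < 1.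
  exact: (Jc _ (near_norm (jacobian F x0) (@ltr01 R))).
have [r r0 hr] := @near_norm_ex R 'rV[R]_m x0 _ (filterI Dx0 J1).
pose K := `|jacobian F x0| + 1.
have K0 : 0 <= K by rewrite addr_ge0.
exists (m%:R * K), r; split; rewrite ?mulr_ge0//.
  by move=> y /hr[].
move=> q p /= qr pr; apply: mean_value_row => // t /andP[t0 t1].
have [|Dt Jt] := hr (p + t *: (q - p)).
  rewrite /= (_ : x0 - _ = (1 - t) *: (x0 - p) + t *: (x0 - q)); last first.
    by apply/rowP => i; rewrite !mxE; ring.
  apply: le_lt_trans (ler_normD _ _) _; rewrite !normrZ !ger0_norm ?subr_ge0//.
  have : Num.max `|x0 - p| `|x0 - q| < r by rewrite gt_max pr qr.
  apply: le_lt_trans; set M := Num.max _ _.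
  have h1 : `|x0 - p| <= M by rewrite le_max lexx.
  have h2 : `|x0 - q| <= M by rewrite le_max lexx orbT.
  have := ler_wpM2l t0 h2; have : 0 <= 1 - t by rewrite subr_ge0.
  by move=> s0; have := ler_wpM2l s0 h1; lra.
split; first by case: (FD _ Dt).
rewrite -[jacobian F _](subKr (jacobian F x0)) /K.
by apply: le_trans (ler_normB _ _) _; rewrite lerD2l ltW.
Qed.

End C1_lipschitz.

Section manifold.
Context {R : realType} {M N : C1manifold R}.
Variable f : M -> N.
Implicit Types (c : chart R M (Defs.dim M)) (d : chart R N (Defs.dim N)).

(** The overlap is the domain of the local representative of the identity map. *)
Lemma chart_overlap_nbhs c c' (y : M) : chart_at y c -> chart_at y c' ->
  nbhs (c y) (c @` (chart_dom c `&` chart_dom c')).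
Proof.
move=> yc yc'; apply: (@local_rep_dom_nbhs R M M (fun x : M => x)) => //.
Qed.

(* Working in a prescribed chart c of the atlas dispenses with showing that C^1
   maps preserve null sets. *)
Lemma locally_lipschitz_chart c (y : M) : locally_lipschitz f -> chart_at y c ->
  exists d V K, [/\ chart_at (f y) d, nbhs (c y) V, 0 <= K
    & lip_in K (local_rep_dom f c d `&` V) (local_rep f c d)].
Proof.
move=> hf yc; have [a [d [ya yd alip]]] := hf y.
have ay : local_rep_dom f a d (a y).
  by exists y => //; split; [case: ya|case: yd].
have [V0 V0a /lipschitz_lip_in[C C0 lipC]] := alip _ ay.
have ov := chart_overlap_nbhs yc ya.
pose tau := a \o chart_inv c.
have cy : chart_inv c (c y) = y by apply: chart_mapK; case: yc.
have C1 : C1_on (c @` (chart_dom c `&` chart_dom a)) tau.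
  by case: (charts_compatible yc.1 ya.1).
have [K [r [K0 r0 sub tlip]]] := C1_on_lip ov C1.
have tc : {for c y, continuous tau}.
  by apply: differentiable_continuous; case: (C1 _ (nbhs_singleton ov)).
have V0t : nbhs (c y) (tau @^-1` V0).
  by apply: tc; rewrite /tau/= cy.
have ny : Filter (nbhs (c y)) := nbhs_filter (c y).
exists d, ([set p | `|c y - p| < r] `&` tau @^-1` V0), (C * K); split=> //.
- by apply: filterI V0t; exact: (@near_norm R 'rV[R]_(Defs.dim M) (c y) r r0).
- by rewrite mulr_ge0// ltW.
(* On the overlap the representative in [c] is the one in [a] composed with the transition map
   [tau]. *)
have key p : (local_rep_dom f c d `&` ([set p | `|c y - p| < r] `&` tau @^-1` V0)) p ->
    (local_rep_dom f a d `&` V0) (tau p) /\ local_rep f c d p = local_rep f a d (tau p).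
  move=> [[w [cw dw] wp] [pr V0p]]; have [w' [cw' aw'] w'p] := sub _ pr.
  have ww' : w = w'.
    by rewrite -(chart_mapK cw) -(chart_mapK cw') wp w'p.
  subst w'.
  have tp : tau p = a w by rewrite /tau/= -wp chart_mapK.
  split; first by split=> //; rewrite tp; exists w.
  by rewrite /local_rep /= tp (chart_mapK aw') -wp chart_mapK.
move=> p q hp hq; have [p1 ->] := key p hp; have [q1 ->] := key q hq.
apply: le_trans (lipC _ _ p1 q1) _; rewrite -mulrA ler_wpM2l ?(ltW C0)//.
by apply: tlip; [case: hp.2|case: hq.2].
Qed.

(* As f need not be continuous, the Lindelof argument is applied to its graph in
   M x N rather than to M. *)
Lemma null_not_differentiable_chart c : locally_lipschitz f ->
  coordinate_chart c ->
  lebesgue_null (c @` ([set x | ~ differentiable_at f x] `&` chart_dom c)).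
Proof.
move=> hf cc.
have [BM cBM [oBM bBM]] := @manifold_second_countable R M.
have [BN cBN [oBN bBN]] := @manifold_second_countable R N.
have [eM eMi] := elimT (countable_injP _) cBM.
have [eN eNi] := elimT (countable_injP _) cBN.
(* A chart of [N], a set and a Lipschitz constant that serve all points of [U] with image in [W] at
   once. *)
pose good U W (p : chart R N (Defs.dim N) * set 'rV[R]_(Defs.dim M) * R) :=
  [/\ coordinate_chart p.1.1, W `<=` chart_dom p.1.1,
      forall y, U y -> nbhs (c y) p.1.2, 0 <= p.2
    & lip_in p.2 (local_rep_dom f c p.1.1 `&` p.1.2) (local_rep f c p.1.1)].
pose Z (i : nat * nat) := [set y | [/\ ~ differentiable_at f y, chart_dom c y
  & exists U W, [/\ BM U /\ eM U = i.1, BN W /\ eN W = i.2, U y, W (f y)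
    & exists p, good U W p]]].
apply: (@lebesgue_null_sub _ _ _ (\bigcup_i (c @` Z i))).
  move=> _ [y [nd cy] <-].
  have [d [V [K [[cd dy] Vy K0 lipK]]]] := locally_lipschitz_chart hf (conj cc cy).
  have cyo : (c y \in c @` chart_dom c) by apply/mem_set; exists y.
  (* The interior makes [V] a neighbourhood of [c w] for every [w] of the basic set [U], not only
     for [y]. *)
  have Uy : nbhs y (chart_dom c `&` c @^-1` V^°).
    have cnb : nbhs y (chart_dom c).
      by apply: open_nbhs_nbhs; split => //; exact: chart_dom_open.
    apply: filterI => //.
    have := @chart_map_continuous _ _ _ c.
    rewrite continuous_open_subspace; last exact: chart_dom_open.
    by move=> /(_ y (mem_set cy)); apply; exact: nbhs_interior.
  have [U [BU Uy'] Usub] := bBM y _ Uy.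
  have [W [BW Wfy] Wsub] := bBN (f y) _
    (open_nbhs_nbhs (conj (chart_dom_open d) dy)).
  exists (eM U, eN W) => //; exists y => //; split=> //.
  exists U, W; split=> //; exists (d, V, K); split=> //= w /Usub[_ h]; exact: h.
apply: lebesgue_null_bigcup => -[i j].
(* [good] does not mention the point, so one [p] is fixed for the whole of [Z (i, j)]. *)
have [[U [W [[BU Ui] [BW Wj] [p Hp]]]]|none] := pselect (exists U W,
    [/\ BM U /\ eM U = i, BN W /\ eN W = j & exists p, good U W p]); last first.
  apply: (@lebesgue_null_sub _ _ _ set0).
    move=> x [y [_ _ [U [W [hU hW _ _ hp]]]] _].
    by apply: none; exists U, W.
  (* The empty cover is taken because in dimension 0 every box has volume 1. *)
  move=> e e0; exists set0, (fun=> 0), (fun=> 0); split=> //.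
  by rewrite esum_set0 lee_fin ltW.
case: Hp => cd Wd UV K0 lipp.
apply: lebesgue_null_sub (null_not_differentiable_on K0 lipp).
move=> _ [y [nd cy [U' [W' [[BU' U'i] [BW' W'j] U'y W'y _]]]] <-].
have UU' : U' = U by apply: eMi; rewrite ?inE// U'i.
have WW' : W' = W by apply: eNi; rewrite ?inE// W'j.
subst U' W'; split; [|exact: UV|].
  by exists y => //; split=> //; exact: Wd.
by move=> dF; apply: nd; exists c, p.1.1; split=> //; split=> //; exact: Wd.
Qed.

End manifold.

Theorem propositionB2 (R : realType) (M N : C1manifold R) (f : M -> N)
    (hf : locally_lipschitz f) :
  almost_everywhere_on (fun x : M => differentiable_at f x).
Proof.
exists [set x | ~ differentiable_at f x] => [c cc|x /contrapT//].
exact: null_not_differentiable_chart.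
Qed.
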